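(* Let $\mathfrak{m}_0\in\mathcal{P}(\mathcal{X})$, and for $N\ge 2$ let $\mathfrak{m}^N=\otimes^N\mathfrak{m}_{0,N}$ with $\mathfrak{m}_{0,N}\in\mathcal{P}(\mathcal{X})$ and $\mathfrak{m}_{0,N}\to\mathfrak{m}_0$ as $N\to\infty$. Assume: (A1) There exists a measurable function $\boldsymbol{w}:[0,\infty)\to[0,1]$ with $\boldsymbol{w}(s)\to 0$ as $s\to 0+$ such that for every $(t,x,a)\in\{0,\ldots,T-1\}\times\mathcal{X}\times\Gamma$ and all $m,\tilde m\in\mathcal{P}(\mathcal{X})$, $$\int_{\mathcal{Z}} \mathbf{1}_{\{\Psi(t,x,m,a,z)\neq\Psi(t,x,\tilde m,a,z)\}}\,\nu(dz)\le \boldsymbol{w}\bigl(\mathsf{dist}(m,\tilde m)\bigr).$$ Moreover, for every $t\in\{0,\ldots,T-1\}$ and every $\tau\in\mathcal{P}(\mathcal{X}\times\mathcal{P}(\mathcal{X})\times\Gamma)$, the map $\Psi(t,\cdot):\mathcal{X}\times\mathcal{P}(\mathcal{X})\times\Gamma\times\mathcal{Z}\to\mathcal{X}$ is $\tau\otimes\nu$-almost everywhere continuous. (A2) The cost coefficients $f$ and $F$ are continuous. Suppose that $\rho\in\mathcal{P}(\mathcal{R}\times\mathcal{P}(\mathcal{X})^{T+1})$ is a correlated solution of the mean field game in restricted strategies with initial distribution $\mathfrak{m}_0$. Factorize $\rho$ as $$\rho(C\times B)=\int_B\rho_1(C\,|\,m)\,\rho_2(dm),\qquad C\subseteq\mathcal{R},\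 B\in\otimes^{T+1}\mathcal{B}(\mathcal{P}(\mathcal{X})),$$ where $\rho_2$ is the marginal of $\rho$ on $\mathcal{P}(\mathcal{X})^{T+1}$ and $\rho_1(\cdot\,|\,\cdot)$ is a probability kernel from $\mathcal{P}(\mathcal{X})^{T+1}$ to $\mathcal{R}$. For each $N$ define $\gamma^N\in\mathcal{P}(\mathcal{R}^N)$ through $$\gamma^N(C_1\times\cdots\times C_N):=\int_{\mathcal{P}(\mathcal{X})^{T+1}}\prod_{i=1}^N\rho_1(C_i\,|\,m)\;\rho_2(dm),\qquad C_1,\ldots,C_N\subseteq\mathcal{R}.$$ Then there exists a sequence $(\epsilon_N)\subset[0,\infty)$ such that, for every $N$, $\gamma^N$ is an $\epsilon_N$-correlated equilibrium in restricted strategies with initial distribution $\mathfrak{m}^N$, and $\epsilon_N\to 0$ as $N\to\infty$.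
   Context: **Data.** For a Polish space $\mathcal{S}$, $\mathcal{P}(\mathcal{S})$ is the space of probability measures on the Borel sets $\mathcal{B}(\mathcal{S})$ with the topology of weak convergence. Finite sets carry the discrete topology. For finite $\mathcal{S}$, $\mathsf{dist}(m,\tilde m):=\frac12\sum_{x\in\mathcal{S}}|m(x)-\tilde m(x)|$ for $m,\tilde m\in\mathcal{P}(\mathcal{S})$. Fixed throughout: $T\in\mathbb{N}$ (time horizon); non-empty finite sets $\mathcal{X}$ (states) and $\Gamma$ (actions); $\mathcal{Z}:=[0,1]$ (noise space) with $\nu$ the uniform distribution on $\mathcal{Z}$; a measurable system function $\Psi:\{0,\ldots,T-1\}\times\mathcal{X}\times\mathcal{P}(\mathcal{X})\times\Gamma\times\mathcal{Z}\to\mathcal{X}$; bounded measurable running costs $f:\{0,\ldots,T-1\}\times\mathcal{X}\times\mathcal{P}(\mathcal{X})\times\Gamma\to\mathbb{R}$; bounded measurable terminal costs $F:\mathcal{X}\times\mathcal{P}(\mathcal{X})\to\mathbb{R}$. The finite set of restricted strategies is $\mathcal{R}:=\{\phi:\{0,\ldots,T-1\}\times\mathcal{X}\to\Gamma\}$, and the finite set of strategy modifications is $\mathcal{U}:=\{u:\mathcal{R}\to\mathcal{R}\}$, with $\mathrm{Id}\in\mathcal{U}$ the identity. For an $\mathcal{R}$-valued random variable $\Phi$, $u\circ\Phi(t,x)$ means $(u(\Phi))(t,x)$. **$N$-player game ($N\ge 2$).** Let $\mathfrak{m}^N\in\mathcal{P}(\mathcal{X}^N)$, $\gamma^N\in\mathcal{P}(\mathcal{R}^N)$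 (a correlated profile), $u\in\mathcal{U}$, $i\in\{1,\ldots,N\}$. A realization of $(\mathfrak{m}^N,\gamma^N,u)$ for player $i$ consists of a probability space $(\Omega,\mathcal{F},\mathbf{P})$ with $\mathcal{R}$-valued random variables $\Phi^N_1,\ldots,\Phi^N_N$, $\mathcal{X}$-valued random variables $X^N_j(t)$ ($1\le j\le N$, $0\le t\le T$) and $\mathcal{Z}$-valued random variables $\xi^N_j(t)$ ($1\le j\le N$, $1\le t\le T$) such that: (i) $(X^N_1(0),\ldots,X^N_N(0))$ has law $\mathfrak{m}^N$; (ii) $(\Phi^N_1,\ldots,\Phi^N_N)$ has law $\gamma^N$; (iii) the $\xi^N_j(t)$ are i.i.d. with law $\nu$; (iv) the three vectors $(\xi^N_j(t))_{j,t}$, $(X^N_j(0))_j$, $(\Phi^N_j)_j$ are independent; (v) $\mathbf{P}$-a.s., for every $t\in\{0,\ldots,T-1\}$, $$X^N_i(t+1)=\Psi\bigl(t,X^N_i(t),\mu^N_i(t),u\circ\Phi^N_i(t,X^N_i(t)),\xi^N_i(t+1)\bigr),$$ $$X^N_j(t+1)=\Psi\bigl(t,X^N_j(t),\mu^N_j(t),\Phi^N_j(t,X^N_j(t)),\xi^N_j(t+1)\bigr),\quad j\ne i,$$ where $\mu^N_l(t):=\frac{1}{N-1}\sum_{j\ne l}\delta_{X^N_j(t)}$. The costs for player $i$ are $$J^N_i(\mathfrak{m}^N,\gamma^N,u):=\mathbf{E}\Bigl[\sum_{t=0}^{T-1}f\bigl(t,X^N_i(t),\mu^N_i(t),u\circ\Phi^N_i(t,X^N_i(t))\bigr)+F\bigl(X^N_i(T),\mu^N_i(T)\bigr)\Bigr],$$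 computed with any realization of $(\mathfrak{m}^N,\gamma^N,u)$ for player $i$ (the value does not depend on the realization). For $\epsilon\ge 0$, $\gamma^N$ is an $\epsilon$-correlated equilibrium in restricted strategies with initial distribution $\mathfrak{m}^N$ if $J^N_i(\mathfrak{m}^N,\gamma^N,\mathrm{Id})\le J^N_i(\mathfrak{m}^N,\gamma^N,u)+\epsilon$ for every $i\in\{1,\ldots,N\}$ and every $u\in\mathcal{U}$. **Mean field game.** Let $\mathfrak{m}_0\in\mathcal{P}(\mathcal{X})$, $\rho\in\mathcal{P}(\mathcal{R}\times\mathcal{P}(\mathcal{X})^{T+1})$ (a correlated flow), $u\in\mathcal{U}$. A realization of $(\mathfrak{m}_0,\rho,u)$ consists of a probability space $(\Omega,\mathcal{F},\mathbf{P})$ with an $\mathcal{R}$-valued $\Phi$, $\mathcal{X}$-valued $X(0),\ldots,X(T)$, $\mathcal{P}(\mathcal{X})$-valued $\mu(0),\ldots,\mu(T)$ and $\mathcal{Z}$-valued $\xi(1),\ldots,\xi(T)$ random variables such that: (i) $X(0)$ has law $\mathfrak{m}_0$; (ii) $(\Phi,\mu(0),\ldots,\mu(T))$ has law $\rho$; (iii) the $\xi(t)$ are i.i.d. with law $\nu$; (iv) $\xi(\cdot)$, $X(0)$ and $(\Phi,\mu(\cdot))$ are independent; (v) $\mathbf{P}$-a.s., for every $t\in\{0,\ldots,T-1\}$, $X(t+1)=\Psi(t,X(t),\mu(t),u\circ\Phi(t,X(t)),\xi(t+1))$. The costs are $$J(\mathfrak{m}_0,\rho,u):=\mathbf{E}\Bigl[\sum_{t=0}^{T-1}f\bigl(t,X(t),\mu(t),u\circ\Phi(t,X(t))\bigr)+F\bigl(X(T),\mu(T)\bigr)\Bigr],$$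 computed with any realization of $(\mathfrak{m}_0,\rho,u)$ (the value does not depend on the realization). The correlated flow $\rho$ is a correlated solution of the mean field game in restricted strategies with initial distribution $\mathfrak{m}_0$ if: (Optimality) $J(\mathfrak{m}_0,\rho,\mathrm{Id})\le J(\mathfrak{m}_0,\rho,u)$ for every $u\in\mathcal{U}$; (Consistency) if $((\Omega,\mathcal{F},\mathbf{P}),\Phi,X(\cdot),\mu(\cdot),\xi(\cdot))$ is a realization of $(\mathfrak{m}_0,\rho,\mathrm{Id})$, then for every $t\in\{0,\ldots,T\}$, $\mu(t)$ is a regular conditional distribution of $X(t)$ given $\mathcal{F}^\mu:=\sigma(\mu(s):s\in\{0,\ldots,T\})$. *)

(* Defs.v *)
From HB Require Import structures.
From mathcomp Require Import all_boot all_order all_algebra.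
From mathcomp Require Import all_classical all_reals all_analysis.

Set Implicit Arguments.
Unset Strict Implicit.
Unset Printing Implicit Defensive.

Import Order.TTheory GRing.Theory Num.Theory.
Import numFieldNormedType.Exports.

Local Open Scope classical_set_scope.
Local Open Scope ring_scope.

(* [Pointed] expresses non-emptiness; the library requires it of every
   measurable space. *)
#[short(type="pfinType")]
HB.structure Definition PointedFinite := {S of Finite S & Pointed S}.

HB.instance Definition _ (I : finType) (S : pfinType) :=
  isPointed.Build {ffun I -> S} [ffun=> point].

(* [disc S] is [S] with the discrete topology and all subsets measurable. *)
Definition disc (S : pfinType) : Type := S.

Section Disc.
Variable S : pfinType.
HB.instance Definition _ := PointedFinite.copy (disc S) S.
HB.instance Definition _ := hasNbhs.Build (disc S) principal_filter.
HB.instance Definition _ := Discrete_ofNbhs.Build (disc S) erefl.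
HB.instance Definition _ := @isMeasurable.Build default_measure_display
  (disc S) setT I (fun _ _ => I) (fun _ _ => I).
End Disc.

Section FiniteProb.
Variables (R : realType) (S : pfinType).

(* Probability measures on a finite set, given by their point masses. *)
Record fprob := FProb {
  mass :> {ffun S -> R};
  _ : [forall x, 0 <= mass x] && (\sum_x mass x == 1) }.

HB.instance Definition _ := [isSub for mass].
HB.instance Definition _ := [Choice of fprob by <:].

Lemma dirac_fprob_subproof (s : S) :
  let d : {ffun S -> R} := [ffun x => (x == s)%:R] in
  [forall x, 0 <= d x] && (\sum_x d x == 1).
Proof.
apply/andP; split; first by apply/forallP => x; rewrite ffunE ler0n.
rewrite (bigD1 s)//= ffunE eqxx big1 ?addr0// => x /negbTE xs.
by rewrite ffunE xs.
Qed.

HB.instance Definition _ := isPointed.Build fprob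
  (FProb (dirac_fprob_subproof point)).

(* The topology of weak convergence: the coarsest one making
   [m |-> \int g dm] continuous for every bounded continuous [g], i.e. for
   every [g : S -> R] as [S] is finite and discrete. *)
HB.instance Definition _ := Topological.copy fprob
  (@initial_topology fprob (prod_topology (fun _ : S -> R => R))
     (fun m g => \sum_x g x * m x)).

(* The Borel sigma-algebra. *)
HB.instance Definition _ :=
  Measurable.copy fprob (g_sigma_algebraType (@open fprob)).

Definition prob (m : fprob) (A : {set S}) : R := \sum_(x in A) m x.

Definition dist (m m' : fprob) : R := 2^-1 * \sum_x `|m x - m' x|.

End FiniteProb.

Section ProductFProb.
Variables (R : realType) (S : pfinType) (N : nat) (m : fprob R S).

Lemma prod_fprob_subproof :
  let d : {ffun {ffun 'I_N -> S} -> R} := [ffun x : {ffun 'I_N -> S} => \prod_(i < N) m (x i)] in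
  [forall x, 0 <= d x] && (\sum_x d x == 1).
Proof.
case: m => p /= /andP[/forallP p0 /eqP p1].
apply/andP; split.
  by apply/forallP => x; rewrite ffunE; apply: prodr_ge0.
under eq_bigr do rewrite ffunE.
by rewrite -(bigA_distr_bigA (fun _ => p)) big1.
Qed.

Definition prod_fprob : fprob R {ffun 'I_N -> S} := FProb prod_fprob_subproof.

End ProductFProb.

Section Empirical.
Variables (R : realType) (S : pfinType) (N : nat) (hN : (1 < N)%N).
Variables (x : 'I_N -> S) (l : 'I_N).

Lemma empirical_subproof :
  let d : {ffun S -> R} :=
    [ffun y => (N.-1)%:R^-1 * \sum_(j < N | j != l) (x j == y)%:R] in
  [forall y, 0 <= d y] && (\sum_y d y == 1).
Proof.
apply/andP; split.
  apply/forallP => y; rewrite ffunE mulr_ge0 ?invr_ge0//.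
  by apply: sumr_ge0.
under eq_bigr do rewrite ffunE.
rewrite -mulr_sumr exchange_big/=.
under eq_bigr => j _.
  rewrite (bigD1 (x j))//= eqxx big1 ?addr0; last first.
    by move=> y /negbTE yx; rewrite eq_sym yx.
  over.
rewrite (sumr_const (predC1 l)) cardC1 card_ord.
by rewrite mulVf// pnatr_eq0 -lt0n -subn1 subn_gt0.
Qed.

(* The empirical measure of the players other than [l]. *)
Definition empirical : fprob R S := FProb empirical_subproof.

End Empirical.

Section Noise.
Variable R : realType.

Definition noise : Type := set_type `[0%R, 1%R : R]%classic.

Definition clamp_val (x : R) : R := Num.max 0 (Num.min 1 x).

Lemma clamp_subproof x : clamp_val x \in `[0%R, 1%R : R]%classic.
Proof.
rewrite inE /clamp_val/= in_itv/= le_max lexx/= ge_max ler01/=.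
by rewrite ge_min lexx.
Qed.

(* The projection of the real line onto [0, 1]. *)
Definition clamp (x : R) : noise := SigSub (clamp_subproof x).

HB.instance Definition _ := Topological.on noise.
HB.instance Definition _ := isPointed.Build noise (clamp 0).
HB.instance Definition _ :=
  Measurable.copy noise (g_sigma_algebraType (@open noise)).

Lemma continuous_clamp : continuous clamp.
Proof.
apply/continuousP => A [B oB <-]; rewrite -comp_preimage.
suff /continuousP : continuous clamp_val by exact.
move=> x; apply: continuous_max; first exact: cst_continuous.
by apply: continuous_min; [exact: cst_continuous|exact: cvg_id].
Qed.

Lemma measurable_clamp : measurable_fun [set: R] clamp.
Proof.
apply: (@measurability _ _ _ _ _ _ (@open noise)) => // _ [B oB <-].
rewrite setTI; apply: measurable_realfun.open_measurable.
by move/continuousP: continuous_clamp; apply.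
Qed.

Definition clamp_mfun : {mfun measurableTypeR R >-> noise} :=
  HB.pack clamp
    (isMeasurableFun.Build _ _ (measurableTypeR R) noise clamp measurable_clamp).

(* The uniform distribution on [0, 1], transported to the subtype [noise];
   [clamp] is the identity on [0, 1], which carries all the mass. *)
Definition unif : probability noise R :=
  distribution (uniform_prob (@ltr01 R)) clamp_mfun.

Lemma unifE (A : set R) : measurable A ->
  unif (set_val @^-1` A) = uniform_prob (@ltr01 R) A.
Proof.
move=> mA; rewrite /unif/= /distribution/= /pushforward /uniform_prob.
rewrite integral_uniform_pdf [RHS]integral_uniform_pdf.
have clampK x : `[0, 1]%classic x -> clamp_val x = x.
  rewrite /clamp_val/= in_itv/= => /andP[x0 x1].
  by rewrite (min_idPr x1) (max_idPr x0).
congr (integral _ _ _); apply/seteqP; split => x /= [Ax x01]; split => //.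
  by move: Ax; rewrite /set_val/= /eqincl/= clampK.
by rewrite /set_val/= /eqincl/= clampK.
Qed.

End Noise.

Section ProbabilityNotions.
Context d (Omega : measurableType d) (R : realType) (P : probability Omega R).

(* For a finite index set the product rule over the whole family subsumes the
   one over subfamilies, by taking some of the [A i] to be [setT]. *)
Definition mutually_independent (I : finType) d' (S : measurableType d')
    (Y : I -> Omega -> S) :=
  forall A : I -> set S, (forall i, measurable (A i)) ->
    P (\bigcap_i (Y i @^-1` A i)) = (\prod_i fine (P (Y i @^-1` A i)))%:E.

Definition iid (I : finType) d' (S : measurableType d')
    (Y : I -> Omega -> S) (nu : probability S R) :=
  (forall i A, measurable A -> P (Y i @^-1` A) = nu A) /\
  mutually_independent Y.

Definition independent3 d1 d2 d3 (S1 : measurableType d1)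
    (S2 : measurableType d2) (S3 : measurableType d3)
    (Y1 : Omega -> S1) (Y2 : Omega -> S2) (Y3 : Omega -> S3) :=
  forall A1 A2 A3, measurable A1 -> measurable A2 -> measurable A3 ->
    (P (Y1 @^-1` A1 `&` Y2 @^-1` A2 `&` Y3 @^-1` A3) =
     P (Y1 @^-1` A1) * P (Y2 @^-1` A2) * P (Y3 @^-1` A3))%E.

Definition has_fin_law (S : pfinType) (Y : Omega -> S) (p : fprob R S) :=
  forall A : {set S}, P (Y @^-1` [set` A]) = (prob p A)%:E.

(* [kappa] is a regular conditional distribution of [Y] given the
   sub-sigma-algebra [G]. *)
Definition regular_cond_dist (S : pfinType) (G : set (set Omega))
    (Y : Omega -> S) (kappa : Omega -> fprob R S) :=
  forall A : {set S},
    (forall D : set R, measurable D ->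
       G ((fun w => prob (kappa w) A) @^-1` D)) /\
    (forall B, G B ->
       P (B `&` Y @^-1` [set` A]) = (\int[P]_(w in B) (prob (kappa w) A)%:E)%E).

End ProbabilityNotions.

Section Games.
Variables (R : realType) (T : nat) (X Gam : pfinType).

Definition strategy := {ffun 'I_T * X -> Gam}.
HB.instance Definition _ := PointedFinite.on strategy.

Definition flow := (T.+1).-tuple (fprob R X).
HB.instance Definition _ := Measurable.on flow.

Definition flow_proj : {mfun (disc strategy * flow)%type >-> flow} :=
  HB.pack (@snd (disc strategy) flow)
    (isMeasurableFun.Build _ _ (disc strategy * flow)%type flow
       (@snd (disc strategy) flow) (@measurable_snd _ _ (disc strategy) flow)).

(* The marginal of a correlated flow on the space of flows of measures. *)
Definition flow_marginal (rho : probability (disc strategy * flow)%type R) :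
    probability flow R := distribution rho flow_proj.

(* The time argument ranges over a finite discrete set, so measurability and
   continuity are required of each time section. *)
Variable Psi : 'I_T -> disc X * fprob R X * disc Gam * noise R -> disc X.
Variable f : 'I_T -> disc X * fprob R X * disc Gam -> R.
Variable F : disc X * fprob R X -> R.

(* For [t : 'I_T], the times [t] and [t + 1] in {0, ..., T}. *)
Definition now (t : 'I_T) : 'I_T.+1 := widen_ord (leqnSn T) t.
Definition next (t : 'I_T) : 'I_T.+1 := lift ord0 t.

Section NPlayer.
Variables (N : nat) (hN : (1 < N)%N).

(* [g_xi (j, t)] is the noise $\xi^N_j(t+1)$. *)
Record game_system := GameSystem {
  g_disp : measure_display;
  g_Omega : measurableType g_disp;
  g_P : probability g_Omega R;
  g_Phi : 'I_N -> {RV g_P >-> disc strategy};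
  g_X : 'I_N -> 'I_T.+1 -> {RV g_P >-> disc X};
  g_xi : 'I_N * 'I_T -> {RV g_P >-> noise R} }.

Section System.
Variables (r : game_system) (u : strategy -> strategy) (i : 'I_N).

Definition g_mu (l : 'I_N) (t : 'I_T.+1) (w : g_Omega r) : fprob R X :=
  empirical (S := X) R hN (fun j => g_X r j t w) l.

Definition g_action (j : 'I_N) (t : 'I_T) (w : g_Omega r) : disc Gam :=
  (if j == i then u (g_Phi r j w) else g_Phi r j w) (t, g_X r j (now t) w).

Definition g_X0 (w : g_Omega r) : disc {ffun 'I_N -> X} :=
  [ffun j => g_X r j ord0 w : X].

Definition g_profile (w : g_Omega r) : disc {ffun 'I_N -> strategy} :=
  [ffun j => g_Phi r j w : strategy].

Definition g_noise (w : g_Omega r) : N.-tuple (T.-tuple (noise R)) :=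
  [tuple [tuple g_xi r (j, t) w | t < T] | j < N].

Record is_game_realization (mN : fprob R {ffun 'I_N -> X})
    (gam : fprob R {ffun 'I_N -> strategy}) : Prop := {
  g_law_X0 : has_fin_law (g_P r) g_X0 mN;
  g_law_profile : has_fin_law (g_P r) g_profile gam;
  g_iid : iid (g_P r) (g_xi r) (unif R);
  g_indep : independent3 (g_P r) g_noise g_X0 g_profile;
  g_dynamics : {ae g_P r, forall w, forall (t : 'I_T) (j : 'I_N),
    g_X r j (next t) w =
    Psi t (g_X r j (now t) w, g_mu j (now t) w, g_action j t w,
           g_xi r (j, t) w)} }.

Definition game_cost_of : R :=
  fine 'E_(g_P r)[fun w =>
    \sum_(t < T) f t (g_X r i (now t) w, g_mu i (now t) w, g_action i t w)
    + F (g_X r i ord_max w, g_mu i ord_max w)].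

End System.

(* The cost computed with any realization: its value does not depend on the
   realization, so an arbitrary one is selected ([0] is a mere default). *)
Definition game_cost (mN : fprob R {ffun 'I_N -> X})
    (gam : fprob R {ffun 'I_N -> strategy}) (u : strategy -> strategy)
    (i : 'I_N) : R :=
  xget 0 [set c | exists2 r : game_system,
    is_game_realization r u i mN gam & c = game_cost_of r u i].

Definition correlated_equilibrium (eps : R) (mN : fprob R {ffun 'I_N -> X})
    (gam : fprob R {ffun 'I_N -> strategy}) :=
  forall (i : 'I_N) (u : strategy -> strategy),
    game_cost mN gam id i <= game_cost mN gam u i + eps.

End NPlayer.

(* [m_xi t] is the noise $\xi(t+1)$. *)
Record mfg_system := MFGSystem {
  m_disp : measure_display;
  m_Omega : measurableType m_disp;
  m_P : probability m_Omega R;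
  m_Phi : {RV m_P >-> disc strategy};
  m_X : 'I_T.+1 -> {RV m_P >-> disc X};
  m_mu : 'I_T.+1 -> {RV m_P >-> fprob R X};
  m_xi : 'I_T -> {RV m_P >-> noise R} }.

Section MeanField.
Variables (r : mfg_system) (u : strategy -> strategy).

Definition m_Phi_flow (w : m_Omega r) : disc strategy * flow :=
  (m_Phi r w, [tuple m_mu r t w | t < T.+1]).

Definition m_noise (w : m_Omega r) : T.-tuple (noise R) :=
  [tuple m_xi r t w | t < T].

Definition m_action (t : 'I_T) (w : m_Omega r) : disc Gam :=
  u (m_Phi r w) (t, m_X r (now t) w).

Record is_mfg_realization (m0 : fprob R X)
    (rho : probability (disc strategy * flow)%type R) : Prop := {
  m_law_X0 : has_fin_law (S := X) (m_P r) (m_X r ord0) m0;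
  m_law_Phi_flow : forall A, measurable A ->
    m_P r (m_Phi_flow @^-1` A) = rho A;
  m_iid : iid (m_P r) (m_xi r) (unif R);
  m_indep : independent3 (m_P r) m_noise (m_X r ord0) m_Phi_flow;
  m_dynamics : {ae m_P r, forall w, forall t : 'I_T,
    m_X r (next t) w =
    Psi t (m_X r (now t) w, m_mu r (now t) w, m_action t w, m_xi r t w)} }.

Definition mfg_cost_of : R :=
  fine 'E_(m_P r)[fun w =>
    \sum_(t < T) f t (m_X r (now t) w, m_mu r (now t) w, m_action t w)
    + F (m_X r ord_max w, m_mu r ord_max w)].

(* The sigma-algebra generated by the flow of measures. *)
Definition mu_sigma : set (set (m_Omega r)) :=
  <<s \bigcup_(s : 'I_T.+1) preimage_set_system setT (m_mu r s) measurable >>.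

End MeanField.

Definition mfg_cost (m0 : fprob R X)
    (rho : probability (disc strategy * flow)%type R)
    (u : strategy -> strategy) : R :=
  xget 0 [set c | exists2 r : mfg_system,
    is_mfg_realization r u m0 rho & c = mfg_cost_of r u].

Definition correlated_solution (m0 : fprob R X)
    (rho : probability (disc strategy * flow)%type R) :=
  (forall u : strategy -> strategy, mfg_cost m0 rho id <= mfg_cost m0 rho u) /\
  (forall r : mfg_system, is_mfg_realization r id m0 rho ->
   forall t : 'I_T.+1,
     regular_cond_dist (S := X) (m_P r) (@mu_sigma r) (m_X r t) (m_mu r t)).

End Games.

(* Main.v *)
Require Import Defs.
From HB Require Import structures.
From mathcomp Require Import all_boot all_order all_algebra.
From mathcomp Require Import all_classical all_reals all_analysis.
From mathcomp Require Import ring lra measurable_realfun.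

Set Implicit Arguments.
Unset Strict Implicit.
Unset Printing Implicit Defensive.

Import Order.TTheory GRing.Theory Num.Theory.
Import numFieldNormedType.Exports.

Local Open Scope classical_set_scope.
Local Open Scope ring_scope.

(** The profile [gam N] is a mixture, over a flow [m] drawn from the second
    marginal of [rho], of products of [N] independent draws from the kernel
    [q = rho1 m]; the costs of both games are therefore integrals over [m], and
    it is enough to compare the integrands.

    All noises are integrated out first. With
    [trans t x m a y = unif {z | Psi t (x, m, a, z) = y}], the states of the
    players given their strategies form a finite Markov chain ([game_law]), and so
    does the state of the representative player given strategy and flow
    ([mf_law]). The costs of arbitrary realizations are finite averages over these
    chains ([game_cost_of_realization], [mfg_cost_of_realization]). Realizations
    are built on product spaces, so that the costs of the games have these values
    ([game_costE], [mfg_costE]) and consistency, which speaks of all realizations,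
    has something to speak about. Consistency then says that almost every flow is
    a fixed point: [m t] is the [q]-mixture of the laws of the chains that it
    drives ([consistency_ae]).

    Fix such a flow and freeze a strategy profile [psi]. The empirical measure of
    the pairs (strategy, state) follows its deterministic limit: one step of the
    chain adds a fluctuation that is small by the law of large numbers and an
    error that the modulus of continuity of [trans] bounds by the distance between
    the empirical measures and [m], which is again bounded by the deviation of the
    pairs because [m] is a fixed point ([controlled_pair_dev]). A deviating player
    is invisible in this argument: the effective profile is just another profile,
    and its strategy frequencies move by [1 / N]. The cost of each player depends
    in the limit on that player's own strategy only ([controlled_profile_cost]),
    and averaging over independent draws from [q] gives the mean field cost of the
    deviation, uniformly in the player and in the deviation
    ([controlled_deviated_cost]).

    So the largest gap between the integrands vanishes for almost every flow, and
    its integral [e N] vanishes by dominated convergence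
    ([cvg_integral_max_gap]). Passing from [id] to the mean field game, using the
    optimality of [rho], and passing back to the deviation [u] costs [2 e N]. *)

(* The next time, not the successor in a cyclic sequence. *)
Local Notation next := Defs.next.

(** * Control of one error term by another *)

Section Controlled.
Variable R : realFieldType.

(** The constant [c] may blow up as [eta] vanishes, so no rate is recorded: this
    is all that a modulus of continuity without any rate can provide, and it is
    uniform over the index set, so that suprema over players and strategy
    modifications come for free. *)
Definition controlled (I : Type) (a b : I -> R) :=
  forall eta, 0 < eta -> exists2 c, 0 <= c & forall i, a i <= eta + c * b i.

Variable I : Type.
Implicit Types a b : I -> R.

Lemma controlled_le a a' b : (forall i, a i <= a' i) ->
  controlled a' b -> controlled a b.
Proof.
move=> aa' h e e0; have [c c0 hc] := h e e0.
by exists c => // i; exact: le_trans (aa' i) (hc i).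
Qed.

Lemma controlled_refl b : controlled b b.
Proof. by move=> e e0; exists 1 => // i; rewrite mul1r lerDr ltW. Qed.

Lemma controlledD a a' b :
  controlled a b -> controlled a' b -> controlled (fun i => a i + a' i) b.
Proof.
move=> h h' e e0; have e2 : 0 < e / 2 by rewrite divr_gt0.
have [c c0 hc] := h _ e2; have [c' c0' hc'] := h' _ e2.
exists (c + c'); first exact: addr_ge0.
move=> i; apply: le_trans (lerD (hc i) (hc' i)) _.
by rewrite le_eqVlt; apply/orP; left; apply/eqP; field.
Qed.

Lemma controlledZ C a b : 0 <= C -> controlled a b ->
  controlled (fun i => C * a i) b.
Proof.
move=> C0 h e e0; have C1 : 0 < C + 1 by rewrite ltr_wpDl.
have [c c0 hc] := h _ (divr_gt0 e0 C1).
exists (C * c); first exact: mulr_ge0.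
move=> i; apply: le_trans (ler_wpM2l C0 (hc i)) _.
rewrite mulrDr [C * (c * _)]mulrA; apply: lerD => //.
by rewrite mulrCA ger_pMr// ler_pdivrMr// mul1r lerDl.
Qed.

Lemma controlled0 b : (forall i, 0 <= b i) -> controlled (fun=> 0) b.
Proof.
by move=> b0 e e0; exists 0 => // i; rewrite mul0r addr0 ltW.
Qed.

Lemma controlled_sum (K : Type) (r : seq K) (a : K -> I -> R) b :
  (forall i, 0 <= b i) -> (forall k, controlled (a k) b) ->
  controlled (fun i => \sum_(k <- r) a k i) b.
Proof.
move=> b0 ab; elim: r => [|k r IH].
  by apply: controlled_le (controlled0 b0) => i; rewrite big_nil.
by apply: controlled_le (controlledD (ab k) IH) => i; rewrite big_cons.
Qed.

Lemma controlled_ler a b b' : (forall i, b i <= b' i) ->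
  controlled a b -> controlled a b'.
Proof.
move=> bb' h e e0; have [c c0 hc] := h e e0; exists c => // i.
by apply: le_trans (hc i) _; rewrite lerD2l ler_wpM2l.
Qed.

Lemma controlled_trans a b b' : controlled a b -> controlled b b' ->
  controlled a b'.
Proof.
move=> h h' e e0; have e2 : 0 < e / 2 by rewrite divr_gt0.
have [c c0 hc] := h _ e2; have [d d0 hd] := controlledZ c0 h' e2.
exists d => // i; apply: le_trans (hc i) _.
by rewrite [in leRHS](splitr e) -addrA lerD2l.
Qed.

Lemma controlled_comp (J : Type) (k : J -> I) a b :
  controlled a b -> controlled (a \o k) (b \o k).
Proof. by move=> h e e0; have [c c0 hc] := h e e0; exists c => // j /=. Qed.

End Controlled.

(** * Averages with finitely many weights *)

Section Mean.
Variable R : realFieldType.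

Definition mean (S : finType) (w h : S -> R) := \sum_s w s * h s.

Definition is_weight (S : finType) (w : S -> R) :=
  (forall s, 0 <= w s) /\ \sum_s w s = 1.

Section OneWeight.
Variables (S : finType) (w : S -> R).
Implicit Types h : S -> R.

Lemma mean_cst (hw : is_weight w) (c : R) : mean w (fun=> c) = c.
Proof. by rewrite /mean -mulr_suml hw.2 mul1r. Qed.

Lemma meanD h h' : mean w (fun s => h s + h' s) = mean w h + mean w h'.
Proof. by rewrite /mean -big_split; apply: eq_bigr => s _; rewrite mulrDr. Qed.

Lemma meanZ (c : R) h : mean w (fun s => c * h s) = c * mean w h.
Proof. by rewrite /mean mulr_sumr; apply: eq_bigr => s _; rewrite mulrCA. Qed.

Lemma meanB h h' : mean w (fun s => h s - h' s) = mean w h - mean w h'.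
Proof. by rewrite /mean -sumrB; apply: eq_bigr => s _; rewrite mulrBr. Qed.

Lemma mean_sum (K : Type) (r : seq K) (h : K -> S -> R) :
  mean w (fun s => \sum_(k <- r) h k s) = \sum_(k <- r) mean w (h k).
Proof.
rewrite /mean exchange_big; apply: eq_bigr => s _; exact: mulr_sumr.
Qed.

Lemma le_mean h h' : is_weight w -> (forall s, h s <= h' s) ->
  mean w h <= mean w h'.
Proof.
by move=> [w0 _] hh; apply: ler_sum => s _; rewrite ler_wpM2l.
Qed.

Lemma mean_ge0 h : is_weight w -> (forall s, 0 <= h s) -> 0 <= mean w h.
Proof. by move=> [w0 _] h0; apply: sumr_ge0 => s _; rewrite mulr_ge0. Qed.

Lemma le_norm_mean h : is_weight w -> `|mean w h| <= mean w (fun s => `|h s|).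
Proof.
move=> [w0 _]; apply: le_trans (ler_norm_sum _ _ _) _.
by apply: ler_sum => s _; rewrite normrM ger0_norm.
Qed.

Lemma norm_mean_le h K : is_weight w -> (forall s, `|h s| <= K) ->
  `|mean w h| <= K.
Proof.
move=> hw hK; apply: le_trans (le_norm_mean _ hw) _.
by rewrite -[leRHS](mean_cst hw); exact: le_mean.
Qed.

End OneWeight.

(** The constant [eta] survives averaging because weights sum to one. *)
Lemma controlled_mean (I : Type) (J : I -> finType) (w : forall i, J i -> R)
    (a b : forall i, J i -> R) : (forall i, is_weight (w i)) ->
  controlled (fun s : {i & J i} => a (tag s) (tagged s))
             (fun s : {i & J i} => b (tag s) (tagged s)) ->
  controlled (fun i => mean (w i) (a i)) (fun i => mean (w i) (b i)).
Proof.
move=> hw h e e0; have [c c0 hc] := h e e0; exists c => // i.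
rewrite -meanZ -[X in _ <= X + _](mean_cst (hw i)) -meanD.
by apply: le_mean => // x; exact: (hc (Tagged J x)).
Qed.

(** * Independent families *)

Definition prodw (N : nat) (S : finType) (P : 'I_N -> S -> R)
    (y : {ffun 'I_N -> S}) := \prod_j P j (y j).

Section Product.
Variables (N : nat) (S : finType) (P : 'I_N -> S -> R).

Lemma sum_prodw : \sum_y prodw P y = \prod_j \sum_s P j s.
Proof. by rewrite bigA_distr_bigA. Qed.

Hypothesis Pw : forall j, is_weight (P j).

Lemma prodw_weight : is_weight (prodw P).
Proof.
split=> [y|]; first by apply: prodr_ge0 => j _; exact: (Pw j).1.
by rewrite sum_prodw big1 // => j _; exact: (Pw j).2.
Qed.

Lemma mean_prodw_mul (g : 'I_N -> S -> R) :
  mean (prodw P) (fun y => \prod_j g j (y j)) = \prod_j mean (P j) (g j).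
Proof.
rewrite bigA_distr_bigA; apply: eq_bigr => y _.
by rewrite /prodw -big_split.
Qed.

Lemma mean_prodw1 (k : 'I_N) (h : S -> R) :
  mean (prodw P) (fun y => h (y k)) = mean (P k) h.
Proof.
transitivity (mean (prodw P)
    (fun y => \prod_j (if j == k then h else fun=> 1) (y j))).
  apply: eq_bigr => y _; congr (_ * _); rewrite (bigD1 k)//= eqxx.
  by rewrite big1 ?mulr1// => j /negbTE ->.
rewrite (mean_prodw_mul (fun j => if j == k then h else fun=> 1)).
rewrite (bigD1 k)//= eqxx big1 ?mulr1// => j /negbTE ->.
exact: mean_cst.
Qed.

Variable c : 'I_N -> S -> R.
Hypothesis c1 : forall j s, `|c j s| <= 1.
Hypothesis c_centered : forall j, mean (P j) (c j) = 0.

(** By independence only the diagonal terms of the square survive. *)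
Lemma mean_sqr_sum_centered :
  mean (prodw P) (fun y => (\sum_j c j (y j)) ^+ 2) <= N%:R.
Proof.
have -> : mean (prodw P) (fun y => (\sum_j c j (y j)) ^+ 2) =
    \sum_j \sum_k mean (prodw P) (fun y => c j (y j) * c k (y k)).
  under [RHS]eq_bigr do rewrite -mean_sum.
  rewrite -mean_sum; apply: eq_bigr => y _; congr (_ * _).
  by rewrite expr2 mulr_suml; apply: eq_bigr => j _; rewrite mulr_sumr.
have -> : N%:R = \sum_(j < N) 1 :> R by rewrite sumr_const card_ord.
apply: ler_sum => j _; rewrite (bigD1 j)//= big1 ?addr0 => [|k kj].
  rewrite -[leRHS](mean_cst prodw_weight); apply: le_mean prodw_weight _ => y.
  by rewrite -expr2 -real_normK ?num_real// expr_le1.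
transitivity (mean (prodw P) (fun y => \prod_l
    (if l == j then c j else if l == k then c k else fun=> 1) (y l))).
  apply: eq_bigr => y _; congr (_ * _).
  rewrite (bigD1 j)//= eqxx (bigD1 k)//= eqxx (negbTE kj).
  by rewrite big1 ?mulr1// => l /andP[/negbTE -> /negbTE ->].
rewrite (mean_prodw_mul
  (fun l => if l == j then c j else if l == k then c k else fun=> 1)).
by rewrite (bigD1 j)//= eqxx c_centered mul0r.
Qed.

(** Weak law of large numbers: [2 |z| <= s z^2 + 1/s] turns the bound on the
    variance into one on the mean absolute deviation without square roots. *)
Lemma mean_abs_average_centered (s : R) : 0 < s -> (0 < N)%N ->
  mean (prodw P) (fun y => `|N%:R^-1 * \sum_j c j (y j)|) <= s^-1 + s / N%:R.
Proof.
move=> s0 N0; have N0' : 0 < N%:R :> R by rewrite ltr0n.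
apply: (@le_trans _ _ (mean (prodw P) (fun y =>
    s^-1 + (s * N%:R^-1 ^+ 2) * (\sum_j c j (y j)) ^+ 2))).
  apply: le_mean prodw_weight _ => y.
  set z := \sum_j _; rewrite -mulrA -exprMn; set v := N%:R^-1 * z.
  rewrite -(real_normK (num_real v)) -(ler_pM2l s0) mulrDr divff ?gt_eqF//.
  have : 0 <= (s * `|v| - 1) ^+ 2 by rewrite sqr_ge0.
  have : 0 <= s * `|v| by rewrite mulr_ge0// ltW.
  nra.
rewrite meanD meanZ mean_cst; last exact: prodw_weight.
rewrite lerD2l (le_trans (ler_wpM2l _ mean_sqr_sum_centered))//.
  by apply: mulr_ge0; [exact: ltW|exact: sqr_ge0].
by rewrite expr2 -!mulrA mulVf ?mulr1// gt_eqF.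
Qed.

End Product.

End Mean.

(** * Laws of the finite chains *)

Section Evolution.
Variables (T : nat) (A : Type) (g : 'I_T -> A -> A) (a0 : A).

(** The recursion runs over [nat] because the generator [g] expects a time with a
    successor; inside the horizon [insub] always returns it. *)
Fixpoint evolve_nat (n : nat) : A :=
  if n is n'.+1 then
    if insub n' is Some t then g t (evolve_nat n') else evolve_nat n'
  else a0.

Definition evolve (t : 'I_T.+1) : A := evolve_nat t.

Lemma evolve0 : evolve ord0 = a0. Proof. by []. Qed.

Lemma evolveS t : evolve (next t) = g t (evolve (now t)).
Proof.
rewrite /evolve/=; case: insubP => [t' _ tt'|].
  by rewrite (_ : t' = t)//; apply: val_inj.
by rewrite ltn_ord.
Qed.

Lemma time_ind (P : 'I_T.+1 -> Prop) : P ord0 ->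
  (forall t, P (now t) -> P (next t)) -> forall t, P t.
Proof.
move=> P0 PS [n]; elim: n => [|n IH] hn.
  by rewrite (_ : Ordinal hn = ord0)//; apply: val_inj.
have hn' : (n < T)%N by rewrite -ltnS.
rewrite (_ : Ordinal hn = next (Ordinal hn')); last exact: val_inj.
apply: PS; rewrite (_ : now _ = Ordinal (ltnW hn)); first exact: IH.
exact: val_inj.
Qed.

End Evolution.

Lemma fprob_weight (R : realType) (S : pfinType) (m : fprob R S) : is_weight m.
Proof. by case: m => p /= /andP[/forallP p0 /eqP p1]. Qed.

Lemma weight_le1 (R : realFieldType) (S : finType) (w : S -> R) s :
  is_weight w -> w s <= 1.
Proof. by move=> [w0 <-]; rewrite (bigD1 s)//= lerDl sumr_ge0. Qed.

Lemma mean_const_weight (R : realFieldType) (S : finType) (a : R) (h : S -> R) :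
  mean (fun=> a) h = a * \sum_s h s.
Proof. by rewrite /mean mulr_sumr. Qed.

Lemma uniform_weight (R : realFieldType) n :
  is_weight (fun _ : 'I_n.+1 => n.+1%:R^-1 : R).
Proof.
split=> [_|]; first by rewrite invr_ge0.
by rewrite sumr_const card_ord -[LHS]mulr_natr mulVf.
Qed.

Lemma sum_eq_mul (R : realFieldType) (S : finType) (s : S) (h : S -> R) :
  \sum_x (s == x)%:R * h x = h s.
Proof.
rewrite (bigD1 s)//= eqxx mul1r big1 ?addr0// => x /negbTE xs.
by rewrite eq_sym xs mul0r.
Qed.

Lemma normr_weight_le1 (R : realFieldType) (S : finType) (w : S -> R) s :
  is_weight w -> `|w s| <= 1.
Proof. by move=> hw; rewrite ger0_norm ?weight_le1//; exact: hw.1. Qed.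

Lemma normr_le_sum (R : realFieldType) (S : finType) (h : S -> R) s :
  `|h s| <= \sum_s' `|h s'|.
Proof. by rewrite (bigD1 s)//= lerDl sumr_ge0. Qed.

Lemma dist_ge0 (R : realType) (S : pfinType) (m1 m2 : fprob R S) : 0 <= dist m1 m2.
Proof. by rewrite mulr_ge0 ?invr_ge0// sumr_ge0. Qed.

Lemma le_dist (R : realType) (S : pfinType) (m1 m2 : fprob R S) y :
  `|m1 y - m2 y| <= 2 * dist m1 m2.
Proof.
by rewrite /dist mulrA divff// mul1r (bigD1 y)//= lerDl sumr_ge0.
Qed.

Section Laws.
Variables (R : realType) (T : nat) (X Gam : pfinType).
Notation strategy := (strategy T X Gam).
Variable p : 'I_T -> X -> fprob R X -> Gam -> X -> R.
Hypothesis p_weight : forall t x m a, is_weight (p t x m a).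

Definition mf_law (m0 : X -> R) (m : flow R T X) (psi : strategy) :
    'I_T.+1 -> X -> R :=
  evolve (fun t l y =>
    mean l (fun x => p t x (tnth m (now t)) (psi (t, x)) y)) m0.

(** The one-step law of the players' states: the noises being independent, the
    players move independently of each other given the current states. *)
Definition game_step (N : nat) (hN : (1 < N)%N)
    (psi : {ffun 'I_N -> strategy}) (t : 'I_T) (x : {ffun 'I_N -> X}) :
    'I_N -> X -> R :=
  fun j => p t (x j) (empirical R hN x j) (psi j (t, x j)).

Definition game_law (N : nat) (hN : (1 < N)%N) (w0 : {ffun 'I_N -> X} -> R)
    (psi : {ffun 'I_N -> strategy}) : 'I_T.+1 -> {ffun 'I_N -> X} -> R :=
  evolve (fun t l y => mean l (fun x => prodw (game_step hN psi t x) y)) w0.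

Lemma mf_lawS m0 m psi t y : mf_law m0 m psi (next t) y =
  mean (mf_law m0 m psi (now t))
    (fun x => p t x (tnth m (now t)) (psi (t, x)) y).
Proof. by rewrite /mf_law evolveS. Qed.

Lemma mean_game_lawS N hN w0 psi t (h : {ffun 'I_N -> X} -> R) :
  mean (game_law hN w0 psi (next t)) h =
  mean (game_law hN w0 psi (now t))
    (fun x => mean (prodw (game_step hN psi t x)) h).
Proof.
rewrite /game_law evolveS -/(game_law hN w0 psi) /mean.
under eq_bigr do rewrite mulr_suml.
rewrite exchange_big; apply: eq_bigr => x _.
by rewrite mulr_sumr; apply: eq_bigr => y _; rewrite mulrA.
Qed.

Lemma game_step_weight N hN psi t (x : {ffun 'I_N -> X}) j :
  is_weight (game_step hN psi t x j).
Proof. exact: p_weight. Qed.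

Lemma mean1 (S : finType) (w : S -> R) : mean w (fun=> 1) = \sum_s w s.
Proof. by apply: eq_bigr => s _; rewrite mulr1. Qed.

Lemma game_law_weight N hN w0 psi t : is_weight w0 ->
  is_weight (@game_law N hN w0 psi t).
Proof.
move=> hw0; elim/time_ind: t => // t IH; split=> [y|].
  rewrite /game_law evolveS; apply: mean_ge0 => // x.
  exact: (prodw_weight (game_step_weight hN psi t x)).1.
rewrite -mean1 mean_game_lawS -[RHS](mean_cst IH); apply: eq_bigr => x _.
by rewrite mean_cst//; exact: prodw_weight (game_step_weight hN psi t x).
Qed.

Lemma mf_law_weight m0 m psi t : is_weight m0 -> is_weight (mf_law m0 m psi t).
Proof.
move=> hw0; elim/time_ind: t => // t IH; split=> [y|].
  by rewrite mf_lawS; apply: mean_ge0 => // x; exact: (p_weight _ _ _ _).1.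
under eq_bigr do rewrite mf_lawS.
rewrite -mean_sum -[RHS](mean_cst IH); apply: eq_bigr => x _.
by rewrite (p_weight _ _ _ _).2.
Qed.

Variable f : 'I_T -> disc X * fprob R X * disc Gam -> R.
Variable F : disc X * fprob R X -> R.

Definition mf_cost (m0 : X -> R) (m : flow R T X) (psi : strategy) : R :=
  \sum_(t < T) mean (mf_law m0 m psi (now t))
     (fun x => f t (x, tnth m (now t), psi (t, x))) +
  mean (mf_law m0 m psi ord_max) (fun x => F (x, tnth m ord_max)).

Definition profile_cost N (hN : (1 < N)%N) w0 (psi : {ffun 'I_N -> strategy})
    (i : 'I_N) : R :=
  \sum_(t < T) mean (game_law hN w0 psi (now t))
     (fun x => f t (x i, empirical R hN x i, psi i (t, x i))) +
  mean (game_law hN w0 psi ord_max) (fun x => F (x i, empirical R hN x i)).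

Definition deviate N (u : strategy -> strategy) (i : 'I_N)
    (phi : {ffun 'I_N -> strategy}) : {ffun 'I_N -> strategy} :=
  [ffun j => if j == i then u (phi j) else phi j].

(** * Propagation of chaos for a frozen strategy profile *)

Section Chaos.
Variables (q : strategy -> R) (m0 : fprob R X) (m0N : nat -> fprob R X).
Variable m : flow R T X.
Hypothesis q_weight : is_weight q.
Hypothesis m_consistent : forall t x,
  tnth m t x = mean q (fun phi => mf_law m0 m phi t x).
Hypothesis p_modulus : forall t x a y,
  controlled (fun mu => `|p t x mu a y - p t x (tnth m (now t)) a y|)
             (fun mu => dist mu (tnth m (now t))).

(** Bundling a profile with its size makes the estimates uniform in the number of
    players; there are at least two of them, whence [n.+2]. *)
Definition profiles := {n : nat & {ffun 'I_n.+2 -> strategy}}.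

Implicit Type k : profiles.
Local Notation states k := {ffun 'I_(tag k).+2 -> X}.
Local Notation emp x j := (@empirical R X _.+2 isT x j).

Let average k (h : 'I_(tag k).+2 -> R) := mean (fun=> (tag k).+2%:R^-1) h.

Definition law k := game_law (N := (tag k).+2) isT
  (prodw (fun=> m0N (tag k).+2)) (tagged k).
Arguments law : clear implicits.

(** The states alone are not enough: the next ones also depend on the strategies,
    so that only the frequencies of the pairs have a closed limit equation. *)
Definition pair_freq k (x : states k) (s : strategy * X) : R :=
  average (fun j => ((tagged k j, x j) == s)%:R).

Definition mf_pair (t : 'I_T.+1) (s : strategy * X) : R :=
  q s.1 * mf_law m0 m s.1 t s.2.

Definition pair_dev t k (x : states k) : R :=
  \sum_s `|pair_freq x s - mf_pair t s|.

Arguments pair_dev t {k} x.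

Definition freq_dev k : R :=
  \sum_phi `|average (fun j => (tagged k j == phi)%:R) - q phi|.

(** The distance to the mean field at time [0], and the size of the fluctuations
    that each step adds. *)
Definition chaos_rate k : R :=
  (tag k).+2%:R^-1 + dist (m0N (tag k).+2) m0 + freq_dev k.

Lemma pair_dev_ge0 t k (x : states k) : 0 <= pair_dev t x.
Proof. by apply: sumr_ge0. Qed.

Lemma chaos_rate_ge0 k : 0 <= chaos_rate k.
Proof. by rewrite !addr_ge0 ?invr_ge0 ?dist_ge0// sumr_ge0. Qed.

Lemma law_weight k t : is_weight (law k t).
Proof. by apply/game_law_weight/prodw_weight => _; exact: fprob_weight. Qed.

Lemma sum_pair_freq k (x : states k) phi (h : X -> R) :
  \sum_y pair_freq x (phi, y) * h y =
  average (fun j => (tagged k j == phi)%:R * h (x j)).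
Proof.
rewrite /pair_freq; under eq_bigr do rewrite mulr_suml.
rewrite exchange_big; apply: eq_bigr => j _.
rewrite -(sum_eq_mul (x j) h) !mulr_sumr; apply: eq_bigr => y _.
by rewrite xpair_eqE -mulnb natrM -!mulrA.
Qed.

(** Removing one player moves the empirical measure by at most [1 / (N - 1)]
    per state; by consistency of [m], its first marginal is the limit. *)
Lemma dist_empirical t k (x : states k) j :
  dist (emp x j) (tnth m t) <=
    #|X|%:R * (tag k).+2%:R^-1 + pair_dev t x.
Proof.
set N := (tag k).+2%:R : R; set N1 := (tag k).+1%:R : R.
have N1gt : 0 < N1 by rewrite ltr0n.
have NE : N = N1 + 1 by rewrite /N -natr1.
have N0 : 0 < N by rewrite NE ltr_pwDr.
have shrink (r a b : R) : 0 < r ->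
    r^-1 * (a - b) - (r + 1)^-1 * a = r^-1 * (a / (r + 1) - b).
  by move=> r0; have r1 := addr_gt0 r0 ltr01; field; rewrite !lt0r_neq0.
have H y : `|emp x j y - tnth m t y| <=
    2 * N^-1 + \sum_phi `|pair_freq x (phi, y) - mf_pair t (phi, y)|.
  pose a := \sum_i (x i == y)%:R : R.
  have aN : a <= N.
    have -> : N = \sum_(i < (tag k).+2) 1 by rewrite sumr_const card_ord.
    by apply: ler_sum => i _; rewrite lern1 leq_b1.
  have empE : emp x j y = N1^-1 * (a - (x j == y)%:R).
    by rewrite ffunE /a [in RHS](bigD1 j)//= addrAC subrr add0r.
  have freqE : \sum_phi pair_freq x (phi, y) = N^-1 * a.
    rewrite /pair_freq -mean_sum mean_const_weight; congr (_ * _).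
    apply: eq_bigr => i _; rewrite (bigD1 (tagged k i))//= xpair_eqE eqxx/=.
    by rewrite big1 ?addr0// => phi /negbTE h; rewrite xpair_eqE eq_sym h.
  rewrite m_consistent.
  have -> : emp x j y - mean q (fun phi => mf_law m0 m phi t y) =
     (emp x j y - N^-1 * a) +
     \sum_phi (pair_freq x (phi, y) - mf_pair t (phi, y)).
    by rewrite sumrB freqE addrA subrK.
  apply: le_trans (ler_normD _ _) _; apply: lerD; last exact: ler_norm_sum.
  rewrite empE.
  have -> : N1^-1 * (a - (x j == y)%:R) - N^-1 * a =
      N1^-1 * (a / N - (x j == y)%:R).
 by rewrite NE shrink.
  have a01 : 0 <= a / N <= 1.
    rewrite ler_pdivrMr// mul1r aN andbT; apply: divr_ge0; last exact: ltW.
    by apply: sumr_ge0 => i _; rewrite ler0n.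
  have b01 : 0 <= ((x j == y)%:R : R) <= 1 by rewrite ler0n lern1 leq_b1.
  rewrite normrM gtr0_norm ?invr_gt0//.
  apply: (@le_trans _ _ (N1^-1 * 1)).
    apply: ler_wpM2l; first by rewrite invr_ge0 ltW.
    move: a01 b01; move: (a / N) ((x j == y)%:R) => r s /andP[r0 r1] /andP[s0 s1].
    by rewrite ler_norml; apply/andP; split; lra.
  rewrite mulr1 -[N1^-1]mul1r ler_pdivrMr// mulrAC ler_pdivlMr// mul1r NE.
  have : 1 <= N1 by rewrite ler1n.
  lra.
rewrite /dist; apply: (@le_trans _ _ (2^-1 * \sum_y (2 * N^-1 +
    \sum_phi `|pair_freq x (phi, y) - mf_pair t (phi, y)|))).
  by rewrite ler_wpM2l ?invr_ge0//; apply: ler_sum => y _; exact: H.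
rewrite big_split/= sumr_const mulrDr; apply: lerD.
  by rewrite -[_ *+ #|X|]mulr_natl mulrCA [2^-1 * _]mulrA mulVf// mul1r.
rewrite exchange_big pair_bigA/=.
rewrite (eq_bigr (fun s => `|pair_freq x s - mf_pair t s|)); last by case.
by rewrite ler_piMl ?pair_dev_ge0// invf_le1// ler1n.
Qed.

(** The strategies being frozen, the indicator of a given pair is, for each player,
    a function of that player's state; for independent states the law of large
    numbers applies to it. *)
Lemma controlled_fluctuation (I : Type) (K : I -> profiles)
    (P : forall i, 'I_(tag (K i)).+2 -> X -> R) :
  (forall i j, is_weight (P i j)) ->
  controlled (fun i => mean (prodw (P i)) (fun y =>
      \sum_s `|pair_freq (k := K i) y s -
                average (fun j => (tagged (K i) j == s.1)%:R * P i j s.2)|))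
    (fun i => (tag (K i)).+2%:R^-1).
Proof.
move=> Pw; apply: (@controlled_le _ _ _ (fun i => \sum_s
    mean (prodw (P i)) (fun y => `|pair_freq (k := K i) y s -
      average (fun j => (tagged (K i) j == s.1)%:R * P i j s.2)|))).
  by move=> i; rewrite -mean_sum.
apply: controlled_sum => [i|[phi y']]; first by rewrite invr_ge0.
(* [s = e^-1] in the law of large numbers leaves [e] as the constant term. *)
move=> e e0; exists e^-1; first by rewrite invr_ge0 ltW.
move=> i; move: (P i) (Pw i); move: (K i) => k Pi Piw /=.
pose c (j : 'I_(tag k).+2) (s : X) : R :=
  (tagged k j == phi)%:R * ((s == y')%:R - Pi j y').
have -> : mean (prodw Pi) (fun y => `|pair_freq y (phi, y') -
    average (fun j => (tagged k j == phi)%:R * Pi j y')|) =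
  mean (prodw Pi) (fun y => `|(tag k).+2%:R^-1 * \sum_j c j (y j)|).
  apply: eq_bigr => y _; congr (_ * `|_|).
  rewrite /pair_freq /average -meanB mean_const_weight; congr (_ * _).
  by apply: eq_bigr => j _; rewrite /c mulrBr -natrM mulnb -xpair_eqE.
have := @mean_abs_average_centered _ _ _ Pi Piw c _ _ e^-1.
rewrite invrK; apply => //; last by rewrite invr_gt0.
- move=> j s; rewrite /c; case: eqP => _; rewrite ?mul0r ?normr0// mul1r.
  have P0 := (Piw j).1 y'.
  have P1 : Pi j y' <= 1 := weight_le1 y' (Piw j).
  by rewrite ler_norml; case: (s == y') => /=; apply/andP; split; lra.
- move=> j; rewrite /c meanZ meanB mean_cst//.
  have -> : mean (Pi j) (fun s => (s == y')%:R) = Pi j y'.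
    rewrite -[RHS](sum_eq_mul y' (Pi j)); apply: eq_bigr => s _.
    by rewrite mulrC eq_sym.
  by rewrite subrr mulr0.
Qed.

Definition configuration := {k : profiles & states k}.
Definition config_players (kx : configuration) : finType := 'I_(tag (tag kx)).+2.
Definition step t (kx : configuration) : config_players kx -> X -> R :=
  game_step (N := (tag (tag kx)).+2) isT (tagged (tag kx)) t (tagged kx).
Arguments step : clear implicits.
Definition local_rate t (kx : configuration) : R :=
  (tag (tag kx)).+2%:R^-1 + pair_dev t (tagged kx).

(** Continuity at [tnth m t] is used along the empirical measures, which are close
    to it for all players at once. *)
Lemma controlled_empirical t (D : fprob R X -> R) :
  controlled D (fun mu => dist mu (tnth m t)) ->
  controlled (fun kxj : {kx : configuration & config_players kx} =>
                D (emp (tagged (tag kxj)) (tagged kxj)))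
             (fun kxj => local_rate t (tag kxj)).
Proof.
move=> Dm; apply: controlled_trans (controlled_comp (fun kxj :
  {kx : configuration & config_players kx} => emp (tagged (tag kxj)) (tagged kxj)) Dm) _.
apply: (@controlled_le _ _ _
    (fun kxj => (#|X|%:R + 1) * local_rate t (tag kxj))).
  move=> [[k x] j] /=; apply: le_trans (dist_empirical _ _ _) _.
  rewrite /local_rate/= mulrDl mul1r mulrDr.
  rewrite -addrA lerD2l ler_wpDl ?mulr_ge0 ?pair_dev_ge0//.
  by rewrite ler_wpDl ?invr_ge0.
by apply: controlledZ; [rewrite addr_ge0|exact: controlled_refl].
Qed.

(** The next frequencies are close to their conditional means. Once the empirical
    measures in these are replaced by [m], the means are linear in the present
    frequencies, and the same linear map sends [mf_pair (now t)] to
    [mf_pair (next t)]. *)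
Lemma controlled_pair_dev_step t :
  controlled (fun kx : configuration => mean (prodw (step t kx))
                 (pair_dev (k := tag kx) (next t)))
    (local_rate (now t)).
Proof.
pose D mu := \sum_x \sum_a \sum_y
   `|p t x mu a y - p t x (tnth m (now t)) a y|.
have D_ge (x : X) mu a y :
    `|p t x mu a y - p t x (tnth m (now t)) a y| <= D mu.
  rewrite /D (bigD1 x)//= (bigD1 a)//= (bigD1 y)//= -!addrA lerDl.
  by rewrite !addr_ge0// !sumr_ge0// => *; rewrite !sumr_ge0// => *; rewrite sumr_ge0.
pose avgD (kx : configuration) := average (k := tag kx) (fun j => D (emp (tagged kx) j)).
have avgD_ctl : controlled avgD (local_rate (now t)).
  have unif kx : is_weight (fun _ : config_players kx => (tag (tag kx)).+2%:R^-1 : R).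
    exact: uniform_weight.
  apply: (@controlled_ler _ _ _ (fun kx => mean
    (fun _ : config_players kx => (tag (tag kx)).+2%:R^-1)
    (fun=> local_rate (now t) kx))).
    by move=> kx; rewrite mean_cst.
  apply: (@controlled_mean _ configuration config_players (fun kx => _)
    (fun kx j => D (emp (tagged kx) j)) (fun kx => _)) => //.
  apply: (@controlled_empirical (now t)).
  do 3![apply: controlled_sum => *; first exact: dist_ge0].
  exact: p_modulus.
pose fluct (kx : configuration) := mean (prodw (step t kx)) (fun y =>
      \sum_s `|pair_freq (k := tag kx) y s - average
        (fun j => (tagged (tag kx) j == s.1)%:R * step t kx j s.2)|).
have fluct_ctl : controlled fluct (local_rate (now t)).
  apply: (@controlled_ler _ _ _ (fun kx => (tag (tag kx)).+2%:R^-1)).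
    by move=> kx; rewrite lerDl pair_dev_ge0.
  apply: (@controlled_fluctuation configuration tag (step t)).
  by move=> *; exact: game_step_weight.
pose C : R := #|{: strategy * X}|%:R.
apply: (@controlled_le _ _ _ (fun kx => fluct kx +
    C * (avgD kx + pair_dev (now t) (tagged kx)))); last first.
  apply: controlledD fluct_ctl _; apply: controlledZ => //.
  apply: controlledD avgD_ctl _.
  apply: controlled_ler (controlled_refl _) => kx.
  by rewrite lerDr invr_ge0.
move=> [k x]; set kx := existT _ _ _ : configuration.
have hw : is_weight (prodw (step t kx)).
  by apply: prodw_weight => j; exact: game_step_weight.
rewrite -[X in _ + X](mean_cst hw) -meanD; apply: le_mean hw _ => y.
rewrite /C -sum1_card natr_sum mulr_suml -big_split/=.
apply: ler_sum => -[phi y'] _ /=; rewrite mul1r.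
(* [A1] is the conditional mean, [A2] the same with [m] in place of the empirical
   measures. *)
set A1 := average _.
pose h x' := p t x' (tnth m (now t)) (phi (t, x')) y'.
pose A2 := average (fun j => (tagged k j == phi)%:R * h (x j)).
have -> : pair_freq y (phi, y') - mf_pair (next t) (phi, y') =
   (pair_freq y (phi, y') - A1) +
   ((A1 - A2) + (A2 - mf_pair (next t) (phi, y'))) by ring.
apply: le_trans (ler_normD _ _) _; rewrite lerD2l.
apply: le_trans (ler_normD _ _) _; apply: lerD.
  rewrite /A1 /A2 /average -meanB; apply: le_trans (le_norm_mean _ _) _.
    exact: uniform_weight.
  apply: le_mean; first exact: uniform_weight.
  move=> j; rewrite -mulrBr normrM normr_nat.
  case: eqP => [jphi|_]; last first.
    by rewrite mul0r !sumr_ge0// => *; rewrite !sumr_ge0// => *; rewrite sumr_ge0.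
  by rewrite mul1r /step /game_step /h /= jphi; exact: D_ge.
rewrite /A2 -sum_pair_freq /mf_pair /= mf_lawS /mean mulr_sumr -sumrB.
apply: le_trans (ler_norm_sum _ _ _) _.
apply: (@le_trans _ _ (\sum_x' `|pair_freq x (phi, x') -
    mf_pair (now t) (phi, x')|)).
  apply: ler_sum => x' _; rewrite mulrA -mulrBl normrM ler_piMr//.
  have pw := p_weight t x' (tnth m (now t)) (phi (t, x')).
  by rewrite ger0_norm; [exact: weight_le1 y' pw|exact: pw.1].
rewrite /pair_dev (eq_bigr (fun s => `|pair_freq x (s.1, s.2) -
  mf_pair (now t) (s.1, s.2)|)) => [|[]//].
rewrite -(pair_bigA _ (fun a b =>
   `|pair_freq x (a, b) - mf_pair (now t) (a, b)|))/= (bigD1 phi)//=.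
by rewrite lerDl sumr_ge0// => *; rewrite sumr_ge0.
Qed.

(** At time [0] the deviation is a fluctuation of independent initial states; the
    steps propagate it. *)
Lemma controlled_pair_dev t :
  controlled (fun k => mean (law k t) (pair_dev t)) chaos_rate.
Proof.
have rateN : controlled (fun k : profiles => (tag k).+2%:R^-1) chaos_rate.
  apply: controlled_ler (controlled_refl _) => k.
  by rewrite /chaos_rate -addrA lerDl addr_ge0 ?dist_ge0 ?sumr_ge0.
elim/time_ind: t => [|t IH].
  pose P k (j : 'I_(tag k).+2) : X -> R := m0N (tag k).+2.
  have Pw k (j : 'I_(tag k).+2) : is_weight (P k j) by exact: fprob_weight.
  have := @controlled_fluctuation _ id P Pw.
  move=> /controlled_trans/(_ rateN); set fluct := (X in controlled X).
  pose C : R := #|{: strategy * X}|%:R.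
  move=> fluct_ctl; apply: (@controlled_le _ _ _
    (fun k => fluct k + C * (2 * chaos_rate k))); last first.
    apply: controlledD fluct_ctl _; do 2![apply: controlledZ => //].
    exact: controlled_refl.
  move=> k; have hw := prodw_weight (Pw k).
  rewrite -[X in _ + X](mean_cst hw) -meanD; apply: le_mean hw _ => y.
  rewrite /C -sum1_card natr_sum mulr_suml -big_split/=.
  apply: ler_sum => -[phi y'] _ /=; rewrite mul1r.
  set A := average _; set B := mf_pair _ _.
  have -> : pair_freq y (phi, y') - B = (pair_freq y (phi, y') - A) + (A - B).
    by rewrite addrA subrK.
  apply: le_trans (ler_normD _ _) _; rewrite lerD2l.
  pose fr := average (fun j => (tagged k j == phi)%:R).
  have -> : A - B = (fr - q phi) * m0N (tag k).+2 y' +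
                    q phi * (m0N (tag k).+2 y' - m0 y').
    rewrite /A /B /fr /average !mean_const_weight -mulr_suml /mf_pair/=.
    by rewrite /mf_law evolve0 /P; ring.
  apply: le_trans (ler_normD _ _) _.
  have h1 : `|(fr - q phi) * m0N (tag k).+2 y'| <= freq_dev k.
    have mw := fprob_weight (m0N (tag k).+2).
    rewrite normrM (ger0_norm (mw.1 _)).
    apply: (@le_trans _ _ `|fr - q phi|).
      by rewrite ler_piMr// weight_le1.
    by rewrite /freq_dev (bigD1 phi)//= lerDl sumr_ge0.
  have h2 : `|q phi * (m0N (tag k).+2 y' - m0 y')| <=
      2 * dist (m0N (tag k).+2) m0.
    rewrite normrM (ger0_norm (q_weight.1 _)).
    apply: (@le_trans _ _ `|m0N (tag k).+2 y' - m0 y'|); last exact: le_dist.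
    by rewrite ler_piMl// weight_le1.
  apply: le_trans (lerD h1 h2) _; rewrite /chaos_rate.
  have : 0 <= (tag k).+2%:R^-1 :> R by rewrite invr_ge0.
  have : 0 <= freq_dev k by exact: sumr_ge0.
  move: (freq_dev k) (dist _ _) (_^-1) => *; lra.
apply: (@controlled_le _ _ _ (fun k => mean (law k (now t)) (fun x =>
    mean (prodw (step t (existT _ k x))) (pair_dev (next t))))).
  by move=> k; rewrite /law mean_game_lawS.
apply: controlled_trans (controlled_mean (J := fun k => states k)
    (b := fun k x => local_rate (now t) (existT _ k x))
    (fun k => law_weight k (now t)) _) _.
  apply: controlled_le (controlled_ler _ (controlled_pair_dev_step t)).
    by move=> -[k x].
  by move=> -[k x].
apply: (@controlled_le _ _ _ (fun k => (tag k).+2%:R^-1 +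
    mean (law k (now t)) (pair_dev (now t)))); last exact: controlledD.
by move=> k; rewrite /local_rate/= meanD mean_cst//; exact: law_weight.
Qed.

Definition tagged_player := {k : profiles & 'I_(tag k).+2}.
Implicit Type kj : tagged_player.

Definition strategy_of kj : strategy := tagged (tag kj) (tagged kj).

Definition state_prob t kj (y : X) : R :=
  mean (law (tag kj) t) (fun x => (x (tagged kj) == y)%:R).

Definition state_dev t kj : R :=
  \sum_y `|state_prob t kj y - mf_law m0 m (strategy_of kj) t y|.

(** The empirical measure is first replaced by [m], at the cost of [pair_dev], then
    the law of the state by the mean field law, at the cost of [state_dev]. *)
Lemma controlled_tagged_mean t (g : X -> fprob R X -> strategy -> R) :
  (forall x phi, controlled (fun mu => `|g x mu phi - g x (tnth m t) phi|)
                            (fun mu => dist mu (tnth m t))) ->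
  controlled (state_dev t) (fun kj => chaos_rate (tag kj)) ->
  controlled (fun kj =>
    `|mean (law (tag kj) t) (fun x => g (x (tagged kj)) (emp x (tagged kj))
                                        (strategy_of kj)) -
      mean (mf_law m0 m (strategy_of kj) t)
        (fun y => g y (tnth m t) (strategy_of kj))|)
    (fun kj => chaos_rate (tag kj)).
Proof.
move=> g_ctl dev_ctl.
pose D mu := \sum_x \sum_phi `|g x mu phi - g x (tnth m t) phi|.
have D_ctl : controlled D (fun mu => dist mu (tnth m t)).
  by do 2![apply: controlled_sum => *; first exact: dist_ge0]; exact: g_ctl.
have avgD : controlled (fun kj => mean (law (tag kj) t)
    (fun x => D (emp x (tagged kj)))) (fun kj => chaos_rate (tag kj)).
  pose J kj := states (tag kj).
  apply: controlled_trans (controlled_mean (J := J)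
    (b := fun kj x => local_rate t (existT _ (tag kj) x))
    (fun kj => law_weight (tag kj) t) _) _.
    exact: (controlled_comp (fun z : {kj : tagged_player & J kj} =>
      existT config_players (existT _ (tag (tag z)) (tagged z)) (tagged (tag z)))
      (controlled_empirical D_ctl)).
  apply: (@controlled_le _ _ _ (fun kj => (tag (tag kj)).+2%:R^-1 +
      mean (law (tag kj) t) (pair_dev t))).
    by move=> kj; rewrite /local_rate/= meanD mean_cst//; exact: law_weight.
  apply: controlledD; last exact: (controlled_comp tag (controlled_pair_dev t)).
  apply: controlled_ler (controlled_refl _) => kj.
  by rewrite /chaos_rate -addrA lerDl addr_ge0 ?dist_ge0 ?sumr_ge0.
pose C := \sum_x \sum_phi `|g x (tnth m t) phi|.
have C0 : 0 <= C by rewrite sumr_ge0// => *; rewrite sumr_ge0.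
have bigle (h : X -> strategy -> R) x phi : (forall x phi, 0 <= h x phi) ->
    h x phi <= \sum_x \sum_phi h x phi.
  move=> h0; rewrite (bigD1 x)//= (bigD1 phi)//= -addrA lerDl addr_ge0//.
    by rewrite sumr_ge0.
  by rewrite sumr_ge0// => *; rewrite sumr_ge0.
apply: (@controlled_le _ _ _ (fun kj => mean (law (tag kj) t)
    (fun x => D (emp x (tagged kj))) + C * state_dev t kj)); last first.
  by apply: controlledD avgD _; exact: controlledZ.
move=> kj; set psi := strategy_of kj; set j := tagged kj.
have hw := law_weight (tag kj) t.
set A := mean _ _; set B := mean (mf_law _ _ _ _) _.
pose A' := mean (law (tag kj) t) (fun x => g (x j) (tnth m t) psi).
have -> : A - B = (A - A') + (A' - B) by rewrite addrA subrK.
apply: le_trans (ler_normD _ _) _; apply: lerD.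
  rewrite /A /A' -meanB; apply: le_trans (le_norm_mean _ hw) _.
  apply: le_mean hw _ => x.
  exact: (bigle (fun x' phi => `|g x' (emp x j) phi - g x' (tnth m t) phi|)).
have -> : A' = \sum_y state_prob t kj y * g y (tnth m t) psi.
  rewrite /A' /state_prob /mean; under [RHS]eq_bigr do rewrite mulr_suml.
  rewrite exchange_big; apply: eq_bigr => x _.
  rewrite -(sum_eq_mul (x j) (fun y => g y (tnth m t) psi)) mulr_sumr.
  by apply: eq_bigr => y _; rewrite mulrA.
rewrite /B /mean -sumrB; apply: le_trans (ler_norm_sum _ _ _) _.
rewrite /state_dev mulr_sumr; apply: ler_sum => y _.
rewrite -mulrBl normrM mulrC ler_wpM2r//.
exact: (bigle (fun x phi => `|g x (tnth m t) phi|)).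
Qed.

(** The law of the next state is the average of a transition probability, to which
    [controlled_tagged_mean] applies. *)
Lemma controlled_state_dev t :
  controlled (state_dev t) (fun kj => chaos_rate (tag kj)).
Proof.
elim/time_ind: t => [|t IH].
  apply: (@controlled_le _ _ _ (fun kj => 2 * chaos_rate (tag kj))); last first.
    by apply: controlledZ => //; exact: controlled_refl.
  move=> kj; apply: (@le_trans _ _ (2 * dist (m0N (tag (tag kj)).+2) m0)).
    rewrite /dist mulrA divff// mul1r; apply: ler_sum => y _.
    rewrite /state_prob /law /game_law /mf_law !evolve0.
    rewrite (mean_prodw1 _ _ (fun z => (z == y)%:R)); last first.
      by move=> j; exact: fprob_weight.
    rewrite (_ : mean _ _ = m0N (tag (tag kj)).+2 y)//.
    rewrite -[RHS](sum_eq_mul y); apply: eq_bigr => s _.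
    by rewrite mulrC eq_sym.
  rewrite ler_wpM2l// /chaos_rate -addrA addrCA lerDl addr_ge0 ?invr_ge0//.
  exact: sumr_ge0.
apply: controlled_sum => [kj|y]; first exact: chaos_rate_ge0.
apply: controlled_le (controlled_tagged_mean
  (g := fun x mu phi => p t x mu (phi (t, x)) y) _ IH); last by move=> x phi.
move=> kj; rewrite mf_lawS /state_prob /law mean_game_lawS -/(law _ _).
rewrite le_eqVlt; apply/orP; left; apply/eqP; congr (`|_ - _|).
apply: eq_bigr => x _; congr (_ * _).
rewrite (mean_prodw1 _ _ (fun z => (z == y)%:R)); last first.
  by move=> j; exact: game_step_weight.
rewrite -[RHS](sum_eq_mul y (fun z => p t (x (tagged kj)) _ _ z)).
by apply: eq_bigr => s _; rewrite mulrC eq_sym.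
Qed.

Hypothesis f_modulus : forall t x a,
  controlled (fun mu => `|f t (x, mu, a) - f t (x, tnth m (now t), a)|)
             (fun mu => dist mu (tnth m (now t))).
Hypothesis F_modulus : forall x,
  controlled (fun mu => `|F (x, mu) - F (x, tnth m ord_max)|)
             (fun mu => dist mu (tnth m ord_max)).

(** The other players only matter through the empirical measures, so the cost of
    any player of a profile depends in the limit on that player's strategy alone. *)
Lemma controlled_profile_cost :
  controlled (fun kj =>
    `|profile_cost (N := (tag (tag kj)).+2) isT (prodw (fun=> m0N (tag (tag kj)).+2))
        (tagged (tag kj)) (tagged kj) - mf_cost m0 m (strategy_of kj)|)
    (fun kj => chaos_rate (tag kj)).
Proof.
have := controlledD
  (controlled_sum (index_enum 'I_T) (fun kj => chaos_rate_ge0 (tag kj))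
     (fun t => controlled_tagged_mean (t := now t)
        (g := fun x mu phi => f t (x, mu, phi (t, x)))
        (fun x phi => f_modulus _ _ _) (controlled_state_dev (now t))))
  (controlled_tagged_mean (t := ord_max) (g := fun x mu phi => F (x, mu))
     (fun x phi => F_modulus _) (controlled_state_dev ord_max)).
apply: controlled_le => kj; rewrite /profile_cost /mf_cost opprD addrACA -sumrB.
apply: le_trans (ler_normD _ _) _; rewrite lerD2r.
exact: ler_norm_sum.
Qed.

Definition deviations := {n : nat & ('I_n.+2 * (strategy -> strategy))%type}.
Implicit Type d : deviations.

Definition deviated d (phi : {ffun 'I_(tag d).+2 -> strategy}) :=
  deviate (tagged d).2 (tagged d).1 phi.

Definition initial_rate (n : nat) : R := n.+2%:R^-1 + dist (m0N n.+2) m0.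

Lemma initial_rate_ge0 n : 0 <= initial_rate n.
Proof. by rewrite addr_ge0 ?invr_ge0 ?dist_ge0. Qed.

(** The deviation of one player changes the frequencies of the strategies by at
    most [1 / N]; those of independent draws from [q] concentrate around [q]. *)
Lemma controlled_deviated_rate : controlled
  (fun d => mean (prodw (fun _ : 'I_(tag d).+2 => q))
              (fun phi => chaos_rate (existT _ (tag d) (deviated phi))))
  (fun d => initial_rate (tag d)).
Proof.
pose G d := mean (prodw (fun _ : 'I_(tag d).+2 => q)) (fun phi =>
  \sum_s `|(tag d).+2%:R^-1 * \sum_j ((phi j == s)%:R - q s)|).
have qw n : is_weight (prodw (fun _ : 'I_n => q)) by apply: prodw_weight.
have G_ctl : controlled G (fun d => initial_rate (tag d)).
  apply: (@controlled_le _ _ _ (fun d => \sum_s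
    mean (prodw (fun _ : 'I_(tag d).+2 => q)) (fun phi =>
      `|(tag d).+2%:R^-1 * \sum_j ((phi j == s)%:R - q s)|))).
    by move=> d; rewrite -mean_sum.
  apply: controlled_sum => [d|s]; first exact: initial_rate_ge0.
  apply: (@controlled_ler _ _ _ (fun d => (tag d).+2%:R^-1)).
    by move=> d; rewrite lerDl dist_ge0.
  move=> e e0; exists e^-1; first by rewrite invr_ge0 ltW.
  move=> d; have := @mean_abs_average_centered _ (tag d).+2 _ (fun=> q)
    (fun=> q_weight) (fun _ phi => (phi == s)%:R - q s) _ _ e^-1.
  rewrite invrK; apply => //; last by rewrite invr_gt0.
    move=> _ phi; have q0 := q_weight.1 s; have q1 := weight_le1 s q_weight.
    by rewrite ler_norml; case: (phi == s) => /=; apply/andP; split; lra.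
  move=> _; rewrite meanB mean_cst// -[X in _ - X](sum_eq_mul s q).
  apply/eqP; rewrite subr_eq0; apply/eqP; apply: eq_bigr => phi _.
  by rewrite mulrC eq_sym.
pose C : R := #|{: strategy}|%:R.
apply: (@controlled_le _ _ _ (fun d => G d + (C + 1) * initial_rate (tag d))).
  move=> d; set N1 : R := (tag d).+2%:R^-1.
  rewrite -[X in _ + X](mean_cst (qw (tag d).+2)) -meanD.
  apply: le_mean (qw _) _ => phi; rewrite /chaos_rate/= -/N1.
  rewrite -/(initial_rate (tag d)) mulrDl mul1r [leLHS]addrC [leRHS]addrA lerD2r.
  apply: (@le_trans _ _ (\sum_s (`|N1 * \sum_j ((phi j == s)%:R - q s)| + N1))).
    apply: ler_sum => s _ /=; rewrite /average mean_const_weight -/N1.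
    have qE : q s = N1 * \sum_(j < (tag d).+2) q s.
      by rewrite sumr_const card_ord -[q s *+ _]mulr_natl mulrA mulVf ?mul1r.
    rewrite [q s in leLHS]qE -mulrBr -sumrB (bigD1 (tagged d).1)//=.
    rewrite [in leRHS](bigD1 (tagged d).1)//=.
    rewrite /deviated (eq_bigr (fun j => (phi j == s)%:R - q s)); last first.
      by move=> j /negbTE ji; rewrite ffunE ji.
    set S := \sum_(j < _ | _) _; set a := (_ == s)%:R; set b := (_ == s)%:R.
    have -> : N1 * (b - q s + S) = N1 * (a - q s + S) + N1 * (b - a) by ring.
    apply: le_trans (ler_normD _ _) _; rewrite lerD2l normrM.
    rewrite ger0_norm ?invr_ge0// ler_piMr ?invr_ge0//.
    by rewrite /a /b; do 2!case: (_ == s) => /=;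
      rewrite ?subrr ?normr0 ?subr0 ?normr1 ?sub0r ?normrN ?normr1.
  rewrite big_split/= lerD2l sumr_const -[N1 *+ _]mulr_natl -/C.
  by rewrite ler_wpM2l// lerDl dist_ge0.
apply: controlledD G_ctl _; apply: controlledZ; first by rewrite addr_ge0.
exact: controlled_refl.
Qed.

(** The mean field cost of a deviation is itself an average over the draw of the
    deviating player, so the two costs are compared draw by draw. *)
Lemma controlled_deviated_cost : controlled
  (fun d => `|mean (prodw (fun _ : 'I_(tag d).+2 => q)) (fun phi =>
      profile_cost (N := (tag d).+2) isT (prodw (fun=> m0N (tag d).+2))
        (deviated phi) (tagged d).1) -
      mean q (fun phi => mf_cost m0 m ((tagged d).2 phi))|)
  (fun d => initial_rate (tag d)).
Proof.
pose J d := {ffun 'I_(tag d).+2 -> strategy}.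
have qw n : is_weight (prodw (fun _ : 'I_n => q)) by apply: prodw_weight.
pose kj (z : {d : deviations & J d}) : tagged_player :=
  existT _ (existT _ (tag (tag z)) (deviated (tagged z))) (tagged (tag z)).1.
have H := controlled_trans (controlled_mean (J := J) (fun d => qw (tag d).+2)
  (a := fun d phi => `|profile_cost (N := (tag d).+2) isT
     (prodw (fun=> m0N (tag d).+2)) (deviated phi) (tagged d).1 -
     mf_cost m0 m (deviated phi (tagged d).1)|)
  (controlled_comp kj controlled_profile_cost)) controlled_deviated_rate.
apply: controlled_le H => d.
rewrite -(mean_prodw1 (fun=> q_weight) (tagged d).1) -meanB.
apply: le_trans (le_norm_mean _ (qw _)) _; apply: le_mean (qw _) _ => phi.
by rewrite [deviated phi _]ffunE eqxx.
Qed.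

End Chaos.
End Laws.

(** * Weak convergence on a finite set is convergence in total variation *)

Section WeakTopology.
Variables (R : realType) (S : pfinType).
Implicit Types m : fprob R S.

Definition dist_balls m : set_system (fprob R S) :=
  filter_from [set d : R | 0 < d] (fun d => [set mu | dist mu m < d]).

Instance dist_balls_filter m : Filter (dist_balls m).
Proof.
apply: filter_from_filter; first by exists 1 => /=.
move=> d d' /= d0 d0'; exists (Order.min d d') => /=.
  by rewrite lt_min d0.
by move=> mu /=; rewrite lt_min => /andP[].
Qed.

(** The weak topology is generated by the integrals of functions on [S], each of
    which is Lipschitz for [dist]. *)
Lemma cvg_dist_balls m : dist_balls m --> m.
Proof.
move=> A [_ [[V Vop <-] Vm sVA]]; apply: filterS sVA _.
pose h : fprob R S -> prod_topology (fun _ : S -> R => R) :=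
  fun mu g => \sum_x g x * mu x.
have : h @ dist_balls m --> h m.
  apply/cvg_sup => g C [_ [[W Wop <-] Wm sWC]]; apply: filterS sWC _.
  have : (fun mu : fprob R S => \sum_x g x * mu x) @ dist_balls m -->
         \sum_x g x * m x.
    apply/cvgrPdist_lt => e e0; pose c := \sum_x `|g x|.
    have c0 : 0 <= c by exact: sumr_ge0.
    have c1 : 0 < 2 * c + 1 by rewrite ltr_wpDl// mulr_ge0.
    exists (e / (2 * c + 1)); first by rewrite /= divr_gt0.
    move=> mu /=; rewrite ltr_pdivlMr// => H.
    rewrite -sumrB; apply: le_lt_trans (ler_norm_sum _ _ _) _.
    apply: (@le_lt_trans _ _ (dist mu m * (2 * c))); last first.
      by apply: le_lt_trans H; rewrite ler_wpM2l ?lerDl// dist_ge0.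
    rewrite mulrCA mulrA mulr_sumr; apply: ler_sum => x _.
    rewrite -mulrBr normrM mulrC ler_wpM2r// distrC; exact: le_dist.
  by apply; apply: open_nbhs_nbhs; split.
by apply; apply: open_nbhs_nbhs; split.
Qed.

Lemma continuous_integral (g : S -> R) :
  continuous (fun mu : fprob R S => \sum_x g x * mu x).
Proof.
pose h : fprob R S -> prod_topology (fun _ : S -> R => R) :=
  fun mu g => \sum_x g x * mu x.
have hc : continuous h by exact: initial_continuous.
have pc : continuous (fun F : prod_topology (fun _ : S -> R => R) => F g).
  exact: (@proj_continuous _ (fun _ : S -> R => R) g).
by move=> mu; exact: (continuous_comp (hc mu) (pc (h mu))).
Qed.

Lemma continuous_mass (x : S) : continuous (fun mu : fprob R S => mu x).
Proof.
rewrite (_ : (fun mu : fprob R S => mu x) =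
  (fun mu => \sum_y (x == y)%:R * mu y)); first exact: continuous_integral.
by apply/funext => mu; rewrite sum_eq_mul.
Qed.

Lemma measurable_mass (x : S) : measurable_fun setT (fun mu : fprob R S => mu x).
Proof.
apply: (measurability _ (RGenOpens.measurableE R)) => _ [_ [a [b ->] <-]].
rewrite setTI; apply: sub_sigma_algebra.
move/continuousP : (@continuous_mass x); apply; exact: interval_open.
Qed.

Lemma cvg_dist (m_ : nat -> fprob R S) m :
  m_ n @[n --> \oo] --> m -> dist (m_ n) m @[n --> \oo] --> (0 : R).
Proof.
move=> mm; suff : dist (m_ n) m @[n --> \oo] --> 2^-1 * \sum_(x : S) (0 : R).
  by rewrite big1 ?mulr0.
apply: cvgM; first exact: cvg_cst.
apply: (cvg_big (op := +%R)) => [|x _]; first exact: add_continuous.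
rewrite -(normr0 R); apply: cvg_norm.
rewrite -(subrr (m x)); apply: cvgB; last exact: cvg_cst.
exact: (cvg_comp _ _ mm (@continuous_mass x m)).
Qed.

(** A bound [|h mu - h m| <= M] takes over away from [m], through the constant
    [M / d] of a ball of radius [d] where [h] varies little. *)
Lemma controlled_near (h : fprob R S -> R) m (M : R) :
  (forall mu, `|h mu - h m| <= M) ->
  (forall eta, 0 < eta -> exists2 d, 0 < d &
     forall mu, dist mu m < d -> `|h mu - h m| <= eta) ->
  controlled (fun mu => `|h mu - h m|) (fun mu => dist mu m).
Proof.
move=> hM hc e e0; have [d d0 hd] := hc e e0.
have M0 : 0 <= M by exact: le_trans (normr_ge0 _) (hM m).
exists (M / d); first by rewrite divr_ge0// ltW.
move=> mu; have [/hd he|dd] := ltP (dist mu m) d.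
  by rewrite (le_trans he)// lerDl mulr_ge0 ?dist_ge0// divr_ge0// ltW.
rewrite (le_trans (hM mu))// ler_wpDl// ?(ltW e0)// mulrAC -mulrA.
by rewrite ler_peMr// ler_pdivlMr// mul1r.
Qed.

Lemma controlled_continuous (h : fprob R S -> R) m (M : R) :
  (forall mu, `|h mu| <= M) -> {for m, continuous h} ->
  controlled (fun mu => `|h mu - h m|) (fun mu => dist mu m).
Proof.
move=> hM hc; apply: (@controlled_near _ _ (M + M)).
  by move=> mu; rewrite (le_trans (ler_normB _ _))// lerD.
move=> e e0; have /cvgrPdist_le/(_ e e0)/cvg_dist_balls[d d0 hd] := hc.
by exists d => // mu /hd; rewrite distrC.
Qed.

End WeakTopology.

(** * Densities, finite laws and product laws *)

Section BoundedIntegrals.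
Context d (T : measurableType d) (R : realType) (P : probability T R).

Lemma bounded_integrable (f : T -> R) (M : R) : measurable_fun setT f ->
  (forall x, `|f x| <= M) -> P.-integrable setT (EFin \o f).
Proof.
move=> mf fM; apply: measurable_bounded_integrable => //.
  by rewrite [X in (X < _)%E]probability_setT ltry.
exists M; split; first exact: num_real.
by move=> r Mr x _ /=; exact: le_trans (fM x) (ltW Mr).
Qed.

Lemma Rintegral_sum (I : Type) (r : seq I) (f : I -> T -> R) :
  (forall i, P.-integrable setT (EFin \o f i)) ->
  \int[P]_x (\sum_(i <- r) f i x) = \sum_(i <- r) \int[P]_x f i x.
Proof.
move=> fi; rewrite /Rintegral.
under eq_integral do rewrite -sumEFin.
rewrite (integral_sum measurableT (fun i => fi i)).
rewrite (eq_bigr (fun i => (fine (\int[P]_x (f i x)%:E))%:E)) ?sumEFin// => i _.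
by rewrite fineK//; exact: (integrable_fin_num measurableT (fi i)).
Qed.

Lemma integral_Rintegral (f : T -> R) D : measurable D ->
  P.-integrable setT (EFin \o f) ->
  (\int[P]_(x in D) (f x)%:E)%E = (\int[P]_(x in D) f x)%:E.
Proof.
move=> mD fi; rewrite /Rintegral fineK//.
by apply: integrable_fin_num => //; exact: integrableS fi.
Qed.

End BoundedIntegrals.

Lemma Rintegral_indicM d (S : measurableType d) (R : realType)
    (mu : {measure set S -> \bar R}) D (g : S -> R) :
  \int[mu]_(x in D) g x = \int[mu]_x (g x * \1_D x).
Proof.
rewrite Rintegral_mkcond; apply: eq_Rintegral => x _.
by rewrite patchE indicE; case: (x \in D); rewrite ?mulr1 ?mulr0.
Qed.

Section FiniteCopy.
Context d (T : measurableType d) (R : realType) (nu : {measure set T -> \bar R}).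
Hypothesis nu_fin : fin_num_fun nu.

(** The measure [nu] under a name that carries the proof of its finiteness, from
    which the structure of a finite measure is inferred. *)
Definition finite_copy : set T -> \bar R := let _ := nu_fin in nu.
HB.instance Definition _ := Measure.copy finite_copy nu.
HB.instance Definition _ := Measure_isFinite.Build _ T R finite_copy nu_fin.

End FiniteCopy.

Section Density.
Context d (T : measurableType d) (R : realType) (P : probability T R).

(** The density of [nu] agrees almost everywhere with its Radon-Nikodym
    derivative. *)
Lemma density_integral (nu : {measure set T -> \bar R}) (k : T -> R)
    (M : R) (g : T -> R) (Mg : R) :
  measurable_fun setT k -> (forall x, `|k x| <= M) ->
  (forall D, measurable D -> nu D = (\int[P]_(x in D) k x)%:E) ->
  measurable_fun setT g -> (forall x, `|g x| <= Mg) ->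
  (\int[nu]_x (g x)%:E)%E = (\int[P]_x (g x * k x))%:E.
Proof.
move=> mk kM nuE mg gM; have ki := bounded_integrable P mk kM.
have nufin : fin_num_fun nu by move=> D mD; rewrite nuE.
pose nu' : {finite_measure set T -> \bar R} := finite_copy nufin.
have nuP : nu' `<< P.
  apply/null_content_dominatesP => A mA PA0.
  rewrite [LHS]nuE// -integral_Rintegral// null_set_integral//.
  exact: measurable_funTS (measurable_int _ ki).
have gi : nu'.-integrable setT (EFin \o g).
  apply: measurable_bounded_integrable => //.
    by rewrite -ge0_fin_numE// nufin.
  exists Mg; split; first exact: num_real.
  by move=> r Mr x _ /=; exact: le_trans (gM x) (ltW Mr).
rewrite -[LHS]/(\int[nu']_x (EFin \o g) x)%E.
rewrite -(Radon_Nikodym_change_of_variables nuP measurableT gi).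
have RNk : ae_eq P setT (Radon_Nikodym (charge_of_finite_measure nu') P)
    (EFin \o k).
  apply: integral_ae_eq => //.
  - exact: Radon_Nikodym_integrable.
  - exact/measurable_EFinP.
  - move=> E _ mE; rewrite -Radon_Nikodym_integral//.
    by rewrite [LHS]nuE// -integral_Rintegral.
rewrite -integral_Rintegral//; last first.
  apply: (@bounded_integrable _ _ _ _ _ (Mg * M)).
    exact: measurable_funM.
  by move=> x; rewrite normrM ler_pM.
apply: ae_eq_integral => //.
- apply: emeasurable_funM; first exact/measurable_EFinP.
  by apply: measurable_int; exact: Radon_Nikodym_integrable.
- by apply/measurable_EFinP; exact: measurable_funM.
- exact: (@ae_eqe_mul2l _ _ _ _ _ _ _ (EFin \o g) RNk).
Qed.

End Density.

Section ProductLaw.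
Context d (Omega : measurableType d) (R : realType) (P : probability Omega R).
Context d1 d2 (S1 : measurableType d1) (S2 : measurableType d2).
Variables (lam : probability S1 R) (nu : probability S2 R).
Variables (A : set Omega) (U : Omega -> S1) (V : Omega -> S2).
Variables (k : S1 -> R) (M : R).
Hypotheses (mA : measurable A) (mU : measurable_fun setT U)
  (mV : measurable_fun setT V).
Hypotheses (mk : measurable_fun setT k) (kM : forall m, `|k m| <= M).

Lemma measurable_preim d' (S : measurableType d') (Y : Omega -> S) B :
  measurable_fun setT Y -> measurable B -> measurable (Y @^-1` B).
Proof. by move=> mY mB; rewrite -[X in measurable X]setTI; exact: mY. Qed.

Let restrE (g : Omega -> R) (Mg : R) : measurable_fun setT g ->
    (forall x, `|g x| <= Mg) ->
  (\int[mrestr P mA]_w (g w)%:E)%E = (\int[P]_w (g w * \1_A w))%:E.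
Proof.
move=> mg gM; apply: (@density_integral _ _ _ P _ _ 1 _ Mg) => //.
- by move=> w; rewrite indicE normr_nat lern1 leq_b1.
- move=> D mD; rewrite -integral_Rintegral//; last first.
    apply: (@bounded_integrable _ _ _ _ _ 1) => // w.
    by rewrite indicE normr_nat lern1 leq_b1.
  by rewrite integral_indic// setIC.
Qed.

Section marginal.
Hypothesis UE : forall D, measurable D ->
  P (A `&` U @^-1` D) = (\int[lam]_(m in D) k m)%:E.

Let image_density : forall D, measurable D ->
  pushforward (mrestr P mA) U D = (\int[lam]_(m in D) k m)%:E.
Proof. by move=> D mD; rewrite -UE// setIC. Qed.

(** On the event [A] the variable [U] has density [k] with respect to [lam]. *)
Lemma integral_event (g : S1 -> R) (Mg : R) : measurable_fun setT g ->
    (forall x, `|g x| <= Mg) ->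
  \int[P]_w (g (U w) * \1_A w) = \int[lam]_m (g m * k m).
Proof.
move=> mg gM; apply: EFin_inj.
rewrite -(restrE (Mg := Mg)); [|exact: measurableT_comp|by []].
rewrite -(density_integral (P := lam) mk kM image_density mg gM).
rewrite integral_pushforward//; first exact/measurable_EFinP.
rewrite preimage_setT; apply: measurable_bounded_integrable => //.
- rewrite [X in (X < _)%E](_ : _ = P (setT `&` A))// setTI.
  by rewrite -ge0_fin_numE// fin_num_measure.
- exact: measurableT_comp.
- exists Mg; split; first exact: num_real.
  by move=> r Mr x _ /=; exact: le_trans (gM _) (ltW Mr).
Qed.

End marginal.

Hypothesis UVE : forall D B, measurable D -> measurable B ->
  P (A `&` U @^-1` D `&` V @^-1` B) = ((\int[lam]_(m in D) k m)%:E * nu B)%E.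

(** If [V] has law [nu] and is independent of [U] on the event [A], then their joint
    law on [A] is a product, as it is on rectangles; its first factor has
    density [k]. *)
Lemma product_law (E : set (S1 * S2)) : measurable E ->
  P (A `&` (fun w => (U w, V w)) @^-1` E) =
  (\int[lam]_m (fine (nu (xsection E m)) * k m))%:E.
Proof.
move=> mE; have mUV := measurable_fun_pair mU mV.
have UE D : measurable D ->
    P (A `&` U @^-1` D) = (\int[lam]_(m in D) k m)%:E.
  move=> mD; have := UVE mD measurableT.
  by rewrite preimage_setT setIT probability_setT mule1.
pose UV w := (U w, V w).
pose image2 : {measure set (S1 * S2) -> \bar R} := pushforward (mrestr P mA) UV.
pose eta2 := image2 mUV.
pose image : {measure set S1 -> \bar R} := pushforward (mrestr P mA) U.
pose eta := image mU.
have etaE D : measurable D -> eta D = (\int[lam]_(m in D) k m)%:E.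
  by move=> mD; rewrite -UE// setIC.
have etafin : fin_num_fun eta by move=> D mD; rewrite etaE.
pose eta' : {finite_measure set S1 -> \bar R} := finite_copy etafin.
have -> : P (A `&` UV @^-1` E) = eta2 E.
  by rewrite setIC.
rewrite -(@product_measure_unique _ _ _ _ _ eta' nu) //; last first.
  move=> D B mD mB; transitivity (eta D * nu B)%E => //.
  rewrite etaE// -UVE//.
  rewrite /= /pushforward /mrestr setIC setIA; congr (P _).
rewrite -(density_integral (nu := eta) (Mg := 1) mk kM etaE).
- apply: eq_integral => m _ /=; rewrite fineK// fin_num_measure//.
  exact: measurable_xsection.
- apply/measurable_EFinP; rewrite (_ : _ \o _ = nu \o xsection E).
    exact: measurable_fun_xsection.
  apply/funext => m /=; rewrite fineK// fin_num_measure//.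
  exact: measurable_xsection.
- move=> m; have mEm : measurable (xsection E m) by exact: measurable_xsection.
  rewrite ger0_norm ?fine_ge0// -lee_fin fineK ?fin_num_measure//.
  exact: probability_le1.
Qed.

End ProductLaw.

Section FiniteLaws.
Context d (Omega : measurableType d) (R : realType) (P : probability Omega R).
Variables (S : pfinType) (Y : Omega -> disc S).

Lemma measurable_to_disc :
  (forall s : S, measurable (Y @^-1` [set s : disc S])) -> measurable_fun setT Y.
Proof.
move=> h _ A _; rewrite setTI.
rewrite (_ : _ @^-1` _ = \bigcup_(s in A) Y @^-1` [set s]).
  apply: fin_bigcup_measurable; first exact: (@finite_finset S).
  by move=> s _; exact: h.
by apply/seteqP; split => [w Aw|w [s As /= ->]]//; exists (Y w).
Qed.

Hypothesis mY : measurable_fun setT Y.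

(** The preimage of a set splits into finitely many measurable pieces, one for
    each value of [Y]. *)
Lemma measurable_disc_choice d' (S' : measurableType d') (h : S -> Omega -> S') :
  (forall s, measurable_fun setT (h s)) ->
  measurable_fun setT (fun w => h (Y w) w).
Proof.
move=> mh _ A mA; rewrite setTI.
rewrite (_ : _ @^-1` _ =
    \bigcup_(s in [set: S]) (Y @^-1` [set s : disc S] `&` h s @^-1` A)).
  apply: fin_bigcup_measurable; first exact: finite_finset.
  move=> s _; apply: measurableI; exact: measurable_preim.
by apply/seteqP; split => [w Aw|w [s _ [/= ->]]]//; exists (Y w).
Qed.

Lemma sum_indic_disc (A : set Omega) (h : S -> R) w :
  \sum_s h s * \1_(A `&` Y @^-1` [set s : disc S]) w = h (Y w) * \1_A w.
Proof.
rewrite (bigD1 (Y w : S))//= big1 ?addr0.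
  rewrite !indicE; congr (_ * (nat_of_bool _)%:R).
  by apply/idP/idP; rewrite !inE// => -[].
move=> s /eqP sY; rewrite indicE memNset ?mulr0// => -[_ /= h'].
exact: sY.
Qed.

Lemma measure_split (mu : {measure set Omega -> \bar R}) (A : set Omega) :
  measurable A -> mu A = \sum_s mu (A `&` Y @^-1` [set s : disc S]).
Proof.
move=> mA; have mAs (s : S) : measurable (A `&` Y @^-1` [set s : disc S]).
  by apply: measurableI => //; exact: measurable_preim.
transitivity (\int[mu]_w \sum_s (\1_(A `&` Y @^-1` [set s : disc S]) w)%:E)%E.
  rewrite -[A in LHS]setIT -integral_indic//; apply: eq_integral => w _.
  rewrite sumEFin -[in LHS](mul1r (\1_A w)) -(sum_indic_disc A (fun=> 1)).
  by congr (_%:E); apply: eq_bigr => s _; rewrite mul1r.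
rewrite ge0_integral_sum//.
- by apply: eq_bigr => s _; rewrite integral_indic// setIT.
- by move=> s; apply/measurable_EFinP; exact: measurable_indic.
Qed.

Lemma expectation_disc (h : S -> R) :
  \int[P]_w h (Y w) = mean (fun s => fine (P (Y @^-1` [set s : disc S]))) h.
Proof.
have mYs (s : S) : measurable (Y @^-1` [set s : disc S]).
  exact: measurable_preim.
have int1 s : P.-integrable setT (EFin \o \1_(Y @^-1` [set s : disc S])).
  apply: (@bounded_integrable _ _ _ _ _ 1) => // w.
  by rewrite indicE normr_nat lern1 leq_b1.
transitivity (\int[P]_w \sum_s h s * \1_(Y @^-1` [set s : disc S]) w).
  apply: eq_Rintegral => w _; rewrite -[LHS]mulr1.
  rewrite -[in LHS](_ : \1_setT w = 1); last by rewrite indicT.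
  by rewrite -(sum_indic_disc setT h); apply: eq_bigr => s _; rewrite setTI.
rewrite Rintegral_sum.
  apply: eq_bigr => s _; rewrite RintegralZl// mulrC; congr (_ * _).
  by rewrite /Rintegral integral_indic// setIT.
move=> s; apply: (@bounded_integrable _ _ _ _ _ `|h s|) => [|w].
  by apply: measurable_funM => //; exact: measurable_indic.
rewrite normrM ler_piMr// indicE normr_nat lern1 leq_b1//.
Qed.

End FiniteLaws.

HB.instance Definition _ (A B : pfinType) := Finite.on (A * B)%type.

Lemma measurable_disc_pair d (Omega : measurableType d) (A B : pfinType)
    (Y : Omega -> disc A) (Z : Omega -> disc B) :
  measurable_fun setT Y -> measurable_fun setT Z ->
  measurable_fun setT (fun w => (Y w, Z w) : disc (A * B)%type).
Proof.
move=> mY mZ; apply: measurable_to_disc => -[a b].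
rewrite (_ : _ @^-1` _ = Y @^-1` [set a] `&` Z @^-1` [set b]).
  by apply: measurableI; exact: measurable_preim.
by apply/seteqP; split => w /= [-> ->].
Qed.

Lemma measurable_disc_ffun d (Omega : measurableType d) (I : finType)
    (A : pfinType) (Y : I -> Omega -> disc A) :
  (forall i, measurable_fun setT (Y i)) ->
  measurable_fun setT (fun w => [ffun i => Y i w : A] : disc {ffun I -> A}).
Proof.
move=> mY; apply: measurable_to_disc => c.
rewrite (_ : _ @^-1` _ = \bigcap_(i in [set: I]) Y i @^-1` [set (c i : disc A)]).
  apply: fin_bigcap_measurable; first exact: finite_finset.
  by move=> i _; exact: measurable_preim.
apply/seteqP; split => w /= h; first by move=> i _ /=; rewrite -h ffunE.
by apply/ffunP => i; rewrite ffunE; exact: h.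
Qed.

Lemma measure_ae_eq d (Omega : measurableType d) (R : realType)
    (P : probability Omega R) (A B : set Omega) :
  measurable A -> measurable B -> {ae P, forall w, A w <-> B w} -> P A = P B.
Proof.
move=> mA mB AB; rewrite -[A]setIT -[B]setIT -!integral_indic//.
apply: ae_eq_integral => //.
- by apply/measurable_EFinP; exact: measurable_indic.
- by apply/measurable_EFinP; exact: measurable_indic.
- apply: filterS AB => w [ab ba] _; congr (_%:E); rewrite !indicE.
  by congr (nat_of_bool _)%:R; apply/idP/idP; rewrite !inE.
Qed.

(** * Transition probabilities *)

Section Transition.
Variables (R : realType) (T : nat) (X Gam : pfinType).
Variable Psi : 'I_T -> disc X * fprob R X * disc Gam * noise R -> disc X.
Hypothesis Psi_meas : forall t, measurable_fun setT (Psi t).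

Definition trans_set t (x : X) (m : fprob R X) (a : Gam) (y : X) :
  set (noise R) := [set z | Psi t (x, m, a, z) = y].

Definition trans t x m a y : R := fine (unif R (trans_set t x m a y)).

Lemma measurable_Psi_section t (x : X) (a : Gam) d (S : measurableType d)
    (m : S -> fprob R X) (z : S -> noise R) :
  measurable_fun setT m -> measurable_fun setT z ->
  measurable_fun setT (fun s => Psi t (x, m s, a, z s)).
Proof.
move=> mm mz; apply: (measurableT_comp (f := Psi t)) => //.
apply: (measurable_fun_pair (f := fun s => (x : disc X, m s, a : disc Gam))) => //.
apply: (measurable_fun_pair (f := fun s => (x : disc X, m s))) => //.
exact: measurable_fun_pair.
Qed.

Lemma measurable_trans_set t x m a y : measurable (trans_set t x m a y).
Proof.
apply: (measurable_preim (Y := fun z => Psi t (x, m, a, z)) (B := [set y])) => //.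
exact: measurable_Psi_section.
Qed.

Lemma trans_weight t x m a : is_weight (trans t x m a).
Proof.
split=> [y|]; first exact: fine_ge0.
have mY : measurable_fun setT (fun z => Psi t (x, m, a, z)).
  exact: measurable_Psi_section.
have := measure_split mY (unif R) measurableT.
rewrite [LHS]probability_setT => h; apply: EFin_inj; rewrite h -sumEFin.
apply: eq_bigr => y _; rewrite setTI /trans fineK// fin_num_measure//.
exact: measurable_trans_set.
Qed.

Lemma measurable_trans t x a y d (S : measurableType d) (m : S -> fprob R X) :
  measurable_fun setT m -> measurable_fun setT (fun s => trans t x (m s) a y).
Proof.
move=> mm; pose E : set (S * noise R) := [set sz | Psi t (x, m sz.1, a, sz.2) = y].
have mE : measurable E.
  apply: (measurable_preim (Y := fun sz => Psi t (x, m sz.1, a, sz.2))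
    (B := [set y])) => //.
  by apply: measurable_Psi_section => //; exact: measurableT_comp.
apply/measurable_EFinP; rewrite (_ : _ \o _ = unif R \o xsection E).
  exact: measurable_fun_xsection.
apply/funext => s /=; rewrite fineK ?fin_num_measure//.
  by congr (unif R _); apply/seteqP; split => z; rewrite /xsection/= inE.
exact: measurable_trans_set.
Qed.

(** The probabilities of two events differ by at most that of the event that
    tells them apart. *)
Lemma trans_modulus (w : R -> R) t x a y (m : fprob R X) :
  (forall s, 0 <= s -> 0 <= w s <= 1) -> w s @[s --> 0^'+] --> (0 : R) ->
  (forall (t : 'I_T) (x : X) (a : Gam) (m m' : fprob R X),
     (\int[unif R]_z
        (\1_[set z | Psi t (x, m, a, z) <> Psi t (x, m', a, z)] z)%:E
        <= (w (dist m m'))%:E)%E) ->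
  controlled (fun mu => `|trans t x mu a y - trans t x m a y|)
             (fun mu => dist mu m).
Proof.
move=> w01 w0 A1.
have diff mu : `|trans t x mu a y - trans t x m a y| <= w (dist mu m).
  pose N := [set z | Psi t (x, mu, a, z) <> Psi t (x, m, a, z)].
  have mN : measurable N.
    rewrite (_ : N = ~` \bigcup_(s in [set: X])
      (trans_set t x mu a s `&` trans_set t x m a s)).
      apply: measurableC; apply: fin_bigcup_measurable; first exact: finite_finset.
      by move=> s _; apply: measurableI; exact: measurable_trans_set.
    apply/seteqP; split => z /=; rewrite /N/=.
      by move=> h [s _ [h1 h2]]; apply: h; rewrite [LHS]h1 [RHS]h2.
    by move=> h e; apply: h; exists (Psi t (x, m, a, z)).
  have mt mu' : measurable (trans_set t x mu' a y) by exact: measurable_trans_set.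
  have half m1 m2 : N = [set z | Psi t (x, m1, a, z) <> Psi t (x, m2, a, z)] ->
      trans t x m1 a y <= trans t x m2 a y + fine (unif R N).
    move=> NE; rewrite /trans -lee_fin EFinD !fineK ?fin_num_measure//.
    apply: le_trans (measureU2 _ _ _) => //.
    rewrite le_measure ?inE//; first exact: measurableU.
    move=> z /= zy; have [e|ne] := pselect (Psi t (x, m1, a, z) = Psi t (x, m2, a, z)).
      by left; rewrite /trans_set/= -e.
    by right; rewrite NE.
  have Nw : fine (unif R N) <= w (dist mu m).
    rewrite -lee_fin fineK ?fin_num_measure//; apply: le_trans (A1 t x a mu m).
    by rewrite integral_indic// setIT.
  apply: le_trans Nw; rewrite ler_distl lerBlDr; apply/andP; split.
    by apply: half; apply/seteqP; split => z /= h /esym.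
  exact: half.
apply: (@controlled_near _ _ (fun mu => trans t x mu a y) m 1).
  by move=> mu; apply: le_trans (diff mu) _; have /andP[] := w01 _ (dist_ge0 mu m).
move=> e e0; have /cvgrPdist_le/(_ e e0)[/= d d0 hd] := w0.
exists d => // mu mud; have [mm|] := eqVneq (dist mu m) 0.
  rewrite (_ : mu = m) ?subrr ?normr0 ?ltW//.
  apply/val_inj/ffunP => s; apply/eqP; rewrite -subr_eq0 -normr_le0.
  by apply: le_trans (le_dist mu m s) _; rewrite mm mulr0.
move=> mm; apply: le_trans (diff mu) _.
have d_gt0 : 0 < dist mu m by rewrite lt_def mm dist_ge0.
have := hd (dist mu m); rewrite /= !sub0r !normrN ger0_norm ?dist_ge0// => /(_ mud d_gt0).
by apply: le_trans; exact: ler_norm.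
Qed.

Lemma measurable_mf_law (m0 : X -> R) psi t x :
  measurable_fun setT (fun m : flow R T X => mf_law trans m0 m psi t x).
Proof.
elim/time_ind: t x => [|t IH] x; first exact: measurable_cst.
rewrite (_ : (fun m => _) = fun m : flow R T X => \sum_x'
  mf_law trans m0 m psi (now t) x' * trans t x' (tnth m (now t)) (psi (t, x')) x).
  apply: measurable_sum => x'; apply: measurable_funM; first exact: IH.
  by apply: measurable_trans; exact: measurable_tnth.
by apply/funext => m; rewrite mf_lawS.
Qed.

End Transition.

(** * The law of a realization of the game *)

Section GameRealization.
Variables (R : realType) (T : nat) (X Gam : pfinType).
Notation strategy := (strategy T X Gam).
Variable Psi : 'I_T -> disc X * fprob R X * disc Gam * noise R -> disc X.
Hypothesis Psi_meas : forall t, measurable_fun setT (Psi t).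
Variables (N : nat) (hN : (1 < N)%N).
Variable r : game_system R T X Gam N.
Variables (u : strategy -> strategy) (i : 'I_N).
Variables (mN : fprob R {ffun 'I_N -> X}) (gam : fprob R {ffun 'I_N -> strategy}).
Hypothesis real : is_game_realization Psi hN r u i mN gam.

Let P := g_P r.

Definition g_states (t : 'I_T.+1) (w : g_Omega r) : disc {ffun 'I_N -> X} :=
  [ffun j => g_X r j t w : X].

Lemma measurable_g_states t : measurable_fun setT (g_states t).
Proof. exact: measurable_disc_ffun. Qed.

Lemma measurable_g_profile : measurable_fun setT (@g_profile _ _ _ _ _ r).
Proof. exact: measurable_disc_ffun. Qed.

Definition noise_event (B : 'I_N * 'I_T -> set (noise R)) : set (g_Omega r) :=
  \bigcap_js g_xi r js @^-1` B js.

Lemma measurable_noise_event B : (forall js, measurable (B js)) ->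
  measurable (noise_event B).
Proof.
move=> mB; apply: fin_bigcap_measurable; first exact: finite_finset.
by move=> js _; apply: measurable_preim.
Qed.

Definition noise_prob (B : 'I_N * 'I_T -> set (noise R)) : R :=
  \prod_js fine (unif R (B js)).

Lemma noise_eventE B : (forall js, measurable (B js)) ->
  P (noise_event B) = (noise_prob B)%:E.
Proof.
move=> mB; rewrite (g_iid real).2//; congr _%:E.
by apply: eq_bigr => js _; rewrite (g_iid real).1.
Qed.

Let law phi := game_law (trans Psi) hN mN (deviate u i phi).

(** The noises of the steps still to come are left free in the sets [B], as the
    next step needs their independence from the present states. *)
Lemma game_realization_law phi (t : 'I_T.+1) x B : (forall js, measurable (B js)) ->
  (forall j (s : 'I_T), (s < t)%N -> B (j, s) = setT) ->
  P (noise_event B `&` @g_profile _ _ _ _ _ r @^-1` [set phi] `&`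
     g_states t @^-1` [set x]) =
  (noise_prob B * gam phi * law phi t x)%:E.
Proof.
elim/time_ind: t x B => [|t IH] x B mB Bpast.
  pose A : set (N.-tuple (T.-tuple (noise R))) :=
    \bigcap_(js in [set: 'I_N * 'I_T])
      (fun z => tnth (tnth z js.1) js.2) @^-1` B js.
  have mA : measurable A.
    apply: fin_bigcap_measurable; first exact: finite_finset.
    move=> [j s] _; apply: (measurable_preim (B := B (j, s))
      (Y := fun z : N.-tuple (T.-tuple (noise R)) => tnth (tnth z j) s)) => //.
    by apply: (measurableT_comp (f := fun z => tnth z s)); exact: measurable_tnth.
  have BA : noise_event B = @g_noise _ _ _ _ _ r @^-1` A.
    apply/seteqP; split => w h [j s] _ /=; have := h (j, s) I; rewrite /=.
      by rewrite !tnth_mktuple.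
    by rewrite !tnth_mktuple.
  rewrite setIAC BA (g_indep real)// -BA noise_eventE//.
  have -> : P (@g_X0 _ _ _ _ _ r @^-1` [set x]) = (mN x)%:E.
    have := g_law_X0 real [set x]%SET; rewrite /prob big_set1 => <-.
    by congr (P _); apply/seteqP; split => w /=; rewrite inE => /eqP.
  have -> : P (@g_profile _ _ _ _ _ r @^-1` [set phi]) = (gam phi)%:E.
    have := g_law_profile real [set phi]%SET; rewrite /prob big_set1 => <-.
    by congr (P _); apply/seteqP; split => w /=; rewrite inE => /eqP.
  by rewrite -!EFinM /law /game_law evolve0 mulrAC.
set A := noise_event B `&` _.
have mpre d (S : measurableType d) (Y : g_Omega r -> S) C :
  measurable_fun setT Y -> measurable C -> measurable (Y @^-1` C).
  exact: measurable_preim.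
have mA : measurable A.
  apply: measurableI; first exact: measurable_noise_event.
  exact: mpre measurable_g_profile _.
rewrite (measure_split (measurable_g_states (now t)) P); last first.
  by apply: measurableI => //; exact: mpre (measurable_g_states _) _.
rewrite /law /game_law evolveS -/(game_law _ _ _ _) -/(law phi) /mean.
rewrite mulr_sumr -sumEFin; apply: eq_bigr => x' _.
pose st := game_step (trans Psi) hN (deviate u i phi) t x'.
(* The transition from [x'] to [x] is the event that the noises of time [t], so far
   unconstrained, lie in the transition sets. *)
pose B' (js : 'I_N * 'I_T) := if js.2 == t then
    trans_set Psi t (x' js.1) (empirical R hN x' js.1)
      (deviate u i phi js.1 (t, x' js.1)) (x js.1)
  else B js.
have mB' js : measurable (B' js).
  by rewrite /B'; case: ifP => // _; exact: measurable_trans_set.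
transitivity (P (noise_event B' `&` @g_profile _ _ _ _ _ r @^-1` [set phi] `&`
     g_states (now t) @^-1` [set x'])).
  apply: measure_ae_eq.
  - apply: measurableI; last exact: mpre (measurable_g_states _) _.
    by apply: measurableI => //; exact: mpre (measurable_g_states _) _.
  - apply: measurableI; last exact: mpre (measurable_g_states _) _.
    apply: measurableI; first exact: measurable_noise_event.
    exact: mpre measurable_g_profile _.
  - apply: filterS (g_dynamics real) => w dyn.
    have key : g_profile w = phi -> g_states (now t) w = x' ->
        (g_states (next t) w = x <-> forall j, B' (j, t) (g_xi r (j, t) w)).
      move=> wphi wx'; rewrite /B'/= eqxx /trans_set/=.
      have E j : g_X r j (next t) w = Psi t (x' j, empirical R hN x' j,
         deviate u i phi j (t, x' j), g_xi r (j, t) w).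
        have xj l : g_X r l (now t) w = x' l by rewrite -wx' ffunE.
        have muj : g_mu hN j (now t) w = empirical R hN x' j.
          by rewrite /g_mu; congr (empirical R hN _ j); apply/funext.
        have aj : g_action u i j t w = deviate u i phi j (t, x' j).
          by rewrite /g_action xj -wphi [deviate _ _ _ _]ffunE ffunE; case: ifP.
        by rewrite dyn xj muj aj.
      split=> [<- j|h]; first by rewrite -E [RHS]ffunE.
      by apply/ffunP => j; rewrite ffunE E; exact: h.
    split=> [[[[hB hphi] hx] hx']|[[hB' hphi] hx']].
      split=> //; split=> // -[j s] _ /=.
      have [st_|ns] := eqVneq s t; last by rewrite /B'/= (negbTE ns); exact: hB.
      by rewrite st_; exact: (key hphi hx').1 hx j.
    split=> //; split; last by apply: (key hphi hx').2 => j; exact: hB' (j, t) I.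
    split=> // -[j s] _ /=; have := hB' (j, s) I; rewrite /= /B'/=.
    by case: eqP => // -> _; rewrite Bpast.
rewrite IH//; last first.
  move=> j s st_; rewrite /B'/= ifF.
    by rewrite Bpast//= (ltn_trans st_) // /bump.
  by apply/negbTE; rewrite neq_ltn st_.
congr (_%:E).
have -> : noise_prob B' = noise_prob B * prodw st x.
  transitivity (noise_prob B *
      \prod_js (if js.2 == t then st js.1 (x js.1) else 1)).
    rewrite /noise_prob -big_split; apply: eq_bigr => -[j s] _ /=.
    rewrite /B'/=; case: eqP => [->|_]; last by rewrite mulr1.
    by rewrite Bpast//= probability_setT mul1r.
  congr (_ * _); rewrite -(pair_bigA _ (fun j s => if s == t then st j (x j) else 1)).
  apply: eq_bigr => j _; rewrite (bigD1 t)//= eqxx big1 ?mulr1// => s.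
  by move/negbTE ->.
by rewrite -/st; ring.
Qed.

Let expectation_states (t : 'I_T.+1)
    (h : {ffun 'I_N -> strategy} -> {ffun 'I_N -> X} -> R) :
  \int[P]_w h (g_profile w) (g_states t w) =
  mean gam (fun phi => mean (law phi t) (h phi)).
Proof.
pose Y w : disc ({ffun 'I_N -> strategy} * {ffun 'I_N -> X})%type :=
  (g_profile w, g_states t w).
have mY : measurable_fun setT Y.
  exact: measurable_disc_pair measurable_g_profile (measurable_g_states t).
rewrite (expectation_disc P mY (fun s => h s.1 s.2)) /mean.
rewrite (eq_bigr (fun s => gam s.1 * law s.1 t s.2 * h s.1 s.2)).
  rewrite -(pair_bigA _ (fun phi x => gam phi * law phi t x * h phi x)).
  by apply: eq_bigr => phi _; rewrite mulr_sumr; apply: eq_bigr => x _; rewrite mulrA.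
move=> [phi x] _; congr (_ * _).
have := @game_realization_law phi t x (fun=> setT) (fun=> measurableT)
  (fun _ _ _ => erefl).
rewrite (_ : noise_event _ = setT) ?setTI; last first.
  by apply/seteqP; split => // w _ js _.
rewrite (_ : noise_prob _ = 1) ?mul1r => [PE|]; last first.
  by rewrite /noise_prob big1// => js _; rewrite probability_setT.
transitivity (fine (P (@g_profile _ _ _ _ _ r @^-1` [set phi] `&`
     g_states t @^-1` [set x]))); last by rewrite PE.
congr (fine (P _)); apply/seteqP; split => w [h1 h2]; first by split.
exact: (f_equal2 pair h1 h2).
Qed.

Variable f : 'I_T -> disc X * fprob R X * disc Gam -> R.
Variable F : disc X * fprob R X -> R.

Lemma game_cost_of_realization : game_cost_of f F hN r u i =
  mean gam (fun phi =>
    profile_cost (trans Psi) f F hN mN (deviate u i phi) i).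
Proof.
pose ht (t : 'I_T) (phi : {ffun 'I_N -> strategy}) (x : {ffun 'I_N -> X}) :=
  f t (x i, empirical R hN x i, deviate u i phi i (t, x i)).
pose hT (phi : {ffun 'I_N -> strategy}) (x : {ffun 'I_N -> X}) :=
  F (x i, empirical R hN x i).
have xi t w : g_X r i t w = g_states t w i by rewrite ffunE.
have mui t w : g_mu hN i t w = empirical R hN (g_states t w) i.
  by rewrite /g_mu; congr (empirical R hN _ i); apply/funext => l; rewrite ffunE.
have ai t w : g_action u i i t w =
    deviate u i (g_profile w) i (t, g_states (now t) w i).
  by rewrite /g_action eqxx [deviate _ _ _ _]ffunE eqxx !ffunE.
transitivity (\int[P]_w (\sum_(t < T) ht t (g_profile w) (g_states (now t) w) +
    hT (g_profile w) (g_states ord_max w))).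
  rewrite /game_cost_of unlock /Rintegral; congr fine.
  apply: eq_integral => w _; congr (_%:E); congr (_ + _).
    by apply: eq_bigr => t _; rewrite xi mui ai.
  by rewrite xi mui.
have int t h : P.-integrable setT
    (EFin \o (fun w => h (g_profile w) (g_states t w))).
  pose Y w : disc ({ffun 'I_N -> strategy} * {ffun 'I_N -> X})%type :=
    (g_profile w, g_states t w).
  pose H (s : disc ({ffun 'I_N -> strategy} * {ffun 'I_N -> X})%type) : R :=
    h s.1 s.2.
  apply: (@bounded_integrable _ _ _ _ _ (\sum_s `|H s|)).
    apply: (measurableT_comp (f := H) (g := Y)); first by [].
    exact: measurable_disc_pair measurable_g_profile (measurable_g_states t).
  by move=> w; exact: (normr_le_sum H (Y w)).
rewrite RintegralD//.
  rewrite Rintegral_sum; last by move=> t; exact: (int (now t) (ht t)).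
  rewrite (expectation_states ord_max hT).
  under eq_bigr do rewrite (expectation_states _ (ht _)).
  by rewrite -mean_sum -meanD.
apply: (@eq_integrable _ _ _ _ _ measurableT (fun w => \sum_(t < T)
  (ht t (g_profile w) (g_states (now t) w))%:E)%E).
  by move=> w _ /=; rewrite sumEFin.
by apply: integrable_sum => // t _; exact: (int (now t) (ht t)).
Qed.

End GameRealization.

(** * The law of a realization of the mean field game *)

Section MFGRealization.
Variables (R : realType) (T : nat) (X Gam : pfinType).
Notation strategy := (strategy T X Gam).
Variable Psi : 'I_T -> disc X * fprob R X * disc Gam * noise R -> disc X.
Hypothesis Psi_meas : forall t, measurable_fun setT (Psi t).
Variables (m0 : fprob R X) (rho : probability (disc strategy * flow R T X)%type R).
Variable rho1 : R.-pker (flow R T X) ~> (disc strategy).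
Hypothesis rho_factor : forall (C : set (disc strategy)) (B : set (flow R T X)),
  measurable B ->
  (rho (C `*` B) = \int[flow_marginal rho]_(m in B) rho1 m C)%E.

Let lam := flow_marginal rho.

Definition kernel_mass (m : flow R T X) (phi : strategy) : R :=
  fine (rho1 m [set phi]).

Lemma kernel_massE m (phi : strategy) :
  rho1 m [set phi] = (kernel_mass m phi)%:E.
Proof.
rewrite fineK// ge0_fin_numE//; apply: le_lt_trans (ltry 1).
by rewrite -(@prob_kernel _ _ _ _ _ rho1 m) le_measure// inE.
Qed.

Lemma kernel_mass_weight m : is_weight (kernel_mass m).
Proof.
split=> [phi|]; first exact: fine_ge0.
apply: EFin_inj; rewrite -sumEFin -(@prob_kernel _ _ _ _ _ rho1 m).
rewrite (measure_split (S := strategy) (Y := id) _ (rho1 m))//.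
by apply: eq_bigr => phi _; rewrite setTI kernel_massE.
Qed.

Lemma measurable_kernel_mass phi :
  measurable_fun setT (fun m => kernel_mass m phi).
Proof.
apply/measurable_EFinP; rewrite (_ : _ \o _ = rho1 ^~ [set phi]).
  exact: measurable_kernel.
by apply/funext => m /=; rewrite kernel_massE.
Qed.

Variable r : mfg_system R T X Gam.
Variable u : strategy -> strategy.
Hypothesis real : is_mfg_realization Psi r u m0 rho.

Let P := m_P r.

Definition m_flow (w : m_Omega r) : flow R T X := [tuple m_mu r t w | t < T.+1].

Lemma measurable_m_flow : measurable_fun setT m_flow.
Proof.
apply/measurable_fun_tnthP => t; rewrite (_ : _ \o _ = m_mu r t)//.
by apply/funext => w /=; rewrite tnth_mktuple.
Qed.

Definition m_noise_event (B : 'I_T -> set (noise R)) : set (m_Omega r) :=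
  \bigcap_s m_xi r s @^-1` B s.

Lemma measurable_m_noise_event B : (forall s, measurable (B s)) ->
  measurable (m_noise_event B).
Proof.
move=> mB; apply: fin_bigcap_measurable; first exact: finite_finset.
by move=> s _; apply: measurable_preim.
Qed.

Definition m_noise_prob (B : 'I_T -> set (noise R)) : R :=
  \prod_s fine (unif R (B s)).

Lemma m_noise_eventE B : (forall s, measurable (B s)) ->
  P (m_noise_event B) = (m_noise_prob B)%:E.
Proof.
move=> mB; rewrite (m_iid real).2//; congr _%:E.
by apply: eq_bigr => s _; rewrite (m_iid real).1.
Qed.

Lemma m_noise_prob01 B : (forall s, measurable (B s)) ->
  0 <= m_noise_prob B <= 1.
Proof.
move=> mB; rewrite -!lee_fin -m_noise_eventE// measure_ge0/=.
by rewrite probability_le1//; exact: measurable_m_noise_event.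
Qed.

Let law m phi := mf_law (trans Psi) m0 m (u phi).
Let dens B phi t x m := m_noise_prob B * (kernel_mass m phi * law m phi t x).

Let measurable_dens B phi t x : measurable_fun setT (dens B phi t x).
Proof.
apply: measurable_funM => //; apply: measurable_funM.
  exact: measurable_kernel_mass.
exact: measurable_mf_law.
Qed.

Let dens_le1 B phi t x m : (forall s, measurable (B s)) ->
  `|dens B phi t x m| <= 1.
Proof.
move=> mB; have /andP[b0 b1] := m_noise_prob01 mB.
have kw := normr_weight_le1 phi (kernel_mass_weight m).
have lw : `|law m phi t x| <= 1.
  apply: normr_weight_le1; apply: mf_law_weight; last exact: fprob_weight.
  exact: trans_weight.
by rewrite !normrM (ger0_norm b0) !mulr_ile1// mulr_ge0.
Qed.

(** The flow is random but independent of the noises, so the transitions at the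
    next time are integrated against the product of their laws. *)
Lemma mfg_realization_law phi (t : 'I_T.+1) x B D :
  (forall s, measurable (B s)) ->
  (forall s : 'I_T, (s < t)%N -> B s = setT) -> measurable D ->
  P (m_noise_event B `&` m_Phi r @^-1` [set phi] `&` m_X r t @^-1` [set x] `&`
     m_flow @^-1` D) = (\int[lam]_(m in D) dens B phi t x m)%:E.
Proof.
have mPhi : measurable (m_Phi r @^-1` [set phi]) by exact: measurable_preim.
have mX t' y : measurable (m_X r t' @^-1` [set y]) by exact: measurable_preim.
have dens_int B' t' y : (forall s, measurable (B' s)) ->
    lam.-integrable setT (EFin \o dens B' phi t' y).
  move=> mB'; apply: (@bounded_integrable _ _ _ _ _ 1) => // m.
  exact: dens_le1.
elim/time_ind: t x B D => [|t IH] x B D mB Bpast mD.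
  pose A : set (T.-tuple (noise R)) := \bigcap_s (fun z => tnth z s) @^-1` B s.
  have mA : measurable A.
    apply: fin_bigcap_measurable; first exact: finite_finset.
    move=> s _; apply: (measurable_preim (Y := fun z => tnth z s)) => //.
    exact: measurable_tnth.
  have BA : m_noise_event B = @m_noise _ _ _ _ r @^-1` A.
    apply/seteqP; split => w h s _ /=; have := h s I; rewrite /=.
      by rewrite tnth_mktuple.
    by rewrite tnth_mktuple.
  have mphiD : measurable ([set phi : disc strategy] `*` D) by exact: measurableX.
  transitivity (P (m_noise_event B `&` m_X r ord0 @^-1` [set x] `&`
      @m_Phi_flow _ _ _ _ r @^-1` ([set phi] `*` D))).
    congr (P _); apply/seteqP; split => w.
      by move=> [[[h1 h2] h3] h4]; split; split.
    by move=> [[h1 h2] [h3 h4]]; do ?split.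
  rewrite BA (m_indep real)// -BA m_noise_eventE//.
  have -> : P (m_X r ord0 @^-1` [set x]) = (m0 x)%:E.
    have := m_law_X0 real [set x]%SET; rewrite /prob big_set1 => <-.
    by congr (P _); apply/seteqP; split => w /=; rewrite inE => /eqP.
  rewrite (m_law_Phi_flow real)// rho_factor//.
  under eq_integral do rewrite kernel_massE.
  rewrite (@integral_Rintegral _ _ _ lam)//; last first.
    apply: (@bounded_integrable _ _ _ _ _ 1); first exact: measurable_kernel_mass.
    by move=> m; exact: normr_weight_le1 (kernel_mass_weight m).
  rewrite -!EFinM; congr (_%:E).
  transitivity (\int[lam]_(m in D) (m_noise_prob B * m0 x * kernel_mass m phi)).
    rewrite RintegralZl//; apply: (integrableS measurableT) => //.
    apply: (@bounded_integrable _ _ _ _ _ 1); first exact: measurable_kernel_mass.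
    by move=> m; exact: normr_weight_le1 (kernel_mass_weight m).
  by apply: eq_Rintegral => m _; rewrite /dens /law /mf_law evolve0; ring.
rewrite (measure_split (Y := m_X r (now t)) _ P)//; last first.
  apply: measurableI; last exact: measurable_preim measurable_m_flow _.
  apply: measurableI => //; apply: measurableI => //.
  exact: measurable_m_noise_event.
pose tr x' m := trans Psi t x' (tnth m (now t)) (u phi (t, x')) x.
have -> : \int[lam]_(m in D) dens B phi (next t) x m =
    \sum_x' \int[lam]_m ((tr x' m * \1_D m) * dens B phi (now t) x' m).
  rewrite -Rintegral_sum => [|x']; last first.
    apply: (@bounded_integrable _ _ _ _ _ 1) => [|m].
      apply: measurable_funM => //; apply: measurable_funM => //.
      by apply: measurable_trans => //; exact: measurable_tnth.
    have h1 : `|tr x' m| <= 1.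
      exact: (normr_weight_le1 (w := trans Psi t x' _ _) x (trans_weight _ _ _ _ _)).
    have h2 : `|\1_D m : R| <= 1 by rewrite indicE normr_nat lern1 leq_b1.
    have h3 := dens_le1 phi (now t) x' m mB.
    by rewrite normrM mulr_ile1// normrM mulr_ile1.
  rewrite Rintegral_indicM; apply: eq_Rintegral => m _.
  rewrite /dens /law mf_lawS /mean !mulr_sumr mulr_suml; apply: eq_bigr => x' _.
  by rewrite -/(tr x' m); ring.
rewrite -sumEFin; apply: eq_bigr => x' _.
pose A := m_noise_event B `&` m_Phi r @^-1` [set phi] `&` m_X r (now t) @^-1` [set x'].
have mA : measurable A.
  by do 2!apply: measurableI => //; exact: measurable_m_noise_event.
pose E : set (flow R T X * noise R) :=
  [set mz | D mz.1 /\ Psi t (x', tnth mz.1 (now t), u phi (t, x'), mz.2) = x].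
have mE : measurable E.
  apply: measurableI.
    exact: (measurable_preim (Y := fst)).
  apply: (measurable_preim (B := [set x]) (Y := fun mz : flow R T X * noise R =>
    Psi t (x', tnth mz.1 (now t), u phi (t, x'), mz.2))) => //.
  apply: measurable_Psi_section => //.
  by apply: (measurableT_comp (f := fun m => tnth m (now t))) => //;
    exact: measurable_tnth.
transitivity (P (A `&` (fun w => (m_flow w, m_xi r t w)) @^-1` E)).
  apply: measure_ae_eq.
  - apply: measurableI => //; apply: measurableI.
      by do 2!apply: measurableI => //; exact: measurable_m_noise_event.
    exact: measurable_preim measurable_m_flow _.
  - apply: measurableI => //; apply: measurable_preim => //.
    exact: measurable_fun_pair measurable_m_flow _.
  - apply: filterS (m_dynamics real) => w dyn.
    have key : m_Phi r w = phi -> m_X r (now t) w = x' -> m_X r (next t) w =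
        Psi t (x', tnth (m_flow w) (now t), u phi (t, x'), m_xi r t w).
      by move=> h1 h2; rewrite dyn /m_action h1 h2 tnth_mktuple.
    split=> [[[[[h1 h2] h3] h4] h5]|[[[h1 h2] h3] [h4 h5]]].
      by split; [split|split=> //=; rewrite -key].
    by split=> //; split=> //; split=> //=; rewrite key.
rewrite (@product_law _ _ _ P _ _ _ _ lam (unif R) A m_flow (m_xi r t)
  (dens B phi (now t) x') 1)//.
- congr (_%:E); apply: eq_Rintegral => m _; congr (_ * _).
  have [Dm|Dm] := pselect (D m).
    rewrite indicE mem_set// mulr1; congr (fine (unif R _)).
    apply/seteqP; split => z; rewrite /xsection/= inE; first by case.
    by split.
  rewrite indicE memNset// mulr0 (_ : xsection E m = set0) ?measure0//.
  by apply/seteqP; split => z //; rewrite /xsection/= inE => -[].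
- exact: measurable_m_flow.
- by move=> m; exact: dens_le1 phi (now t) x' m mB.
move=> D' C mD' mC; pose B' s := if s == t then C else B s.
have mB' s : measurable (B' s) by rewrite /B'; case: ifP.
have Bt : B t = setT by rewrite Bpast.
transitivity (P (m_noise_event B' `&` m_Phi r @^-1` [set phi] `&`
    m_X r (now t) @^-1` [set x'] `&` m_flow @^-1` D')).
  congr (P _); apply/seteqP; split => w.
    move=> [[[[h1 h2] h3] h4] h5]; split=> //; split=> //; split=> // s _.
    by rewrite /B'/=; case: eqP => [->|_]; [exact: h5|exact: h1].
  move=> [[[h1 h2] h3] h4]; split; [split=> //; split=> //; split=> // s _|].
    by have := h1 s I; rewrite /B'/=; case: eqP => // ->; rewrite Bt.
  by have := h1 t I; rewrite /B'/= eqxx.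
rewrite IH//; last first.
  move=> s st; rewrite /B' ifF; first by rewrite Bpast//= (ltn_trans st).
  by apply/negbTE; rewrite neq_ltn st.
have -> : unif R C = (fine (unif R C))%:E by rewrite fineK// fin_num_measure.
rewrite -EFinM -RintegralZr//; last exact: integrableS (dens_int B (now t) x' mB).
congr (_%:E); apply: eq_Rintegral => m _.
have -> : dens B' phi (now t) x' m = m_noise_prob B' *
  (kernel_mass m phi * law m phi (now t) x') by [].
have -> : m_noise_prob B' = fine (unif R C) * m_noise_prob B.
  rewrite /m_noise_prob (bigD1 t)//= [in RHS](bigD1 t)//= Bt probability_setT.
  rewrite mul1r {1}/B' eqxx; congr (_ * _); apply: eq_bigr => s /negbTE st.
  by rewrite /B' st.
by rewrite /dens; ring.
Qed.

Lemma mfg_event_law phi t x D : measurable D ->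
  P (m_Phi r @^-1` [set phi] `&` m_X r t @^-1` [set x] `&` m_flow @^-1` D) =
  (\int[lam]_(m in D) (kernel_mass m phi * law m phi t x))%:E.
Proof.
move=> mD; have := @mfg_realization_law phi t x (fun=> setT) D
  (fun=> measurableT) (fun _ _ => erefl) mD.
rewrite (_ : m_noise_event _ = setT) ?setTI; last first.
  by apply/seteqP; split => // w _ s _.
move=> ->; congr (_%:E); apply: eq_Rintegral => m _.
rewrite /dens /m_noise_prob big1 ?mul1r// => s _.
by rewrite probability_setT.
Qed.

Let measurable_joint phi t x :
  measurable_fun setT (fun m => kernel_mass m phi * law m phi t x).
Proof.
apply: measurable_funM; first exact: measurable_kernel_mass.
exact: measurable_mf_law.
Qed.

Let joint_le1 phi t x m : `|kernel_mass m phi * law m phi t x| <= 1.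
Proof.
rewrite normrM mulr_ile1//; first exact: normr_weight_le1 (kernel_mass_weight m).
apply: normr_weight_le1; apply: mf_law_weight; last exact: fprob_weight.
exact: trans_weight.
Qed.

Lemma mfg_expectation t (g : strategy -> X -> flow R T X -> R) (M : R) :
  (forall phi x, measurable_fun setT (g phi x)) ->
  (forall phi x m, `|g phi x m| <= M) ->
  \int[P]_w g (m_Phi r w) (m_X r t w) (m_flow w) =
  \int[lam]_m mean (kernel_mass m)
    (fun phi => mean (law m phi t) (fun x => g phi x m)).
Proof.
move=> mg gM; have M0 : 0 <= M by exact: le_trans (gM point point point).
pose Y w : disc (strategy * X)%type := (m_Phi r w, m_X r t w).
have mY : measurable_fun setT Y by exact: measurable_disc_pair.
pose A (s : strategy * X) := m_Phi r @^-1` [set s.1] `&` m_X r t @^-1` [set s.2].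
have mA s : measurable (A s) by apply: measurableI; exact: measurable_preim.
transitivity (\int[P]_w \sum_s g s.1 s.2 (m_flow w) * \1_(A s) w).
  apply: eq_Rintegral => w _.
  have := sum_indic_disc Y setT (fun s => g s.1 s.2 (m_flow w)) w.
  rewrite indicT mulr1 => <-; apply: eq_bigr => -[phi x] _ /=.
  rewrite setTI; congr (_ * \1_ _ w).
  by apply/seteqP; split => w' /= [h1 h2]; [split|rewrite /Y h1 h2].
rewrite Rintegral_sum => [|s]; last first.
  apply: (@bounded_integrable _ _ _ _ _ M) => [|w].
    apply: measurable_funM; last exact: measurable_indic.
    by apply: measurableT_comp => //; exact: measurable_m_flow.
  by rewrite normrM -[M]mulr1 ler_pM// indicE normr_nat lern1 leq_b1.
transitivity (\sum_s \int[lam]_m (g s.1 s.2 m *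
    (kernel_mass m s.1 * law m s.1 t s.2))).
  apply: eq_bigr => -[phi x] _ /=.
  apply: (integral_event (P := P) (lam := lam) (A := A (phi, x)) (U := m_flow)
    (k := fun m => kernel_mass m phi * law m phi t x) (M := 1) _ _ _ _ _
    (mg phi x) (gM phi x)) => //.
  - exact: measurable_m_flow.
  - by move=> D mD; exact: mfg_event_law.
rewrite -Rintegral_sum => [|s]; last first.
  apply: (@bounded_integrable _ _ _ _ _ M) => [|m]; first exact: measurable_funM.
  by rewrite normrM -[M]mulr1 ler_pM.
apply: eq_Rintegral => m _; rewrite /mean.
rewrite -(pair_bigA _ (fun phi x => g phi x m * (kernel_mass m phi * law m phi t x))).
apply: eq_bigr => phi _; rewrite mulr_sumr; apply: eq_bigr => x _ /=; ring.
Qed.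

Variable f : 'I_T -> disc X * fprob R X * disc Gam -> R.
Variable F : disc X * fprob R X -> R.
Hypotheses (f_meas : forall t, measurable_fun setT (f t))
  (F_meas : measurable_fun setT F).
Variable M : R.
Hypotheses (f_le : forall t y, `|f t y| <= M) (F_le : forall y, `|F y| <= M).

Lemma measurable_running (t : 'I_T) (x : X) (a : Gam) :
  measurable_fun setT (fun m : flow R T X => f t (x, tnth m (now t), a)).
Proof.
apply: (measurableT_comp (f := f t)) => //.
apply: (measurable_fun_pair (f := fun m : flow R T X =>
  (x : disc X, tnth m (now t)))) => //.
by apply: measurable_fun_pair => //; exact: measurable_tnth.
Qed.

Lemma measurable_terminal (x : X) :
  measurable_fun setT (fun m : flow R T X => F (x, tnth m ord_max)).
Proof.
apply: (measurableT_comp (f := F)) => //.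
by apply: measurable_fun_pair => //; exact: measurable_tnth.
Qed.

Lemma measurable_mf_cost psi :
  measurable_fun setT (fun m => mf_cost (trans Psi) f F m0 m psi).
Proof.
apply: measurable_funD.
  apply: measurable_sum => t; apply: measurable_sum => x; apply: measurable_funM.
    exact: measurable_mf_law.
  exact: measurable_running.
apply: measurable_sum => x; apply: measurable_funM; last exact: measurable_terminal.
exact: measurable_mf_law.
Qed.

Lemma normr_mf_cost m psi : `|mf_cost (trans Psi) f F m0 m psi| <= T%:R * M + M.
Proof.
have lw t : is_weight (mf_law (trans Psi) m0 m psi t).
  by apply: mf_law_weight; [exact: trans_weight|exact: fprob_weight].
apply: le_trans (ler_normD _ _) _; apply: lerD; last exact: norm_mean_le.
apply: le_trans (ler_norm_sum _ _ _) _.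
rewrite mulr_natl -[T in leRHS]card_ord -sumr_const; apply: ler_sum => t _.
exact: norm_mean_le.
Qed.

Lemma mfg_cost_of_realization : mfg_cost_of f F r u =
  \int[lam]_m mean (kernel_mass m)
    (fun phi => mf_cost (trans Psi) f F m0 m (u phi)).
Proof.
pose gt (t : 'I_T) phi x (m : flow R T X) := f t (x, tnth m (now t), u phi (t, x)).
pose gT (phi : strategy) x (m : flow R T X) := F (x, tnth m ord_max).
have mgt t phi x : measurable_fun setT (gt t phi x) by exact: measurable_running.
have mgT phi x : measurable_fun setT (gT phi x) by exact: measurable_terminal.
have int t (g : strategy -> X -> flow R T X -> R) :
    (forall phi x, measurable_fun setT (g phi x)) ->
    (forall phi x m, `|g phi x m| <= M) ->
    P.-integrable setT (EFin \o (fun w => g (m_Phi r w) (m_X r t w) (m_flow w))).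
  move=> mg gM; apply: (@bounded_integrable _ _ _ _ _ M) => //.
  apply: (@measurable_disc_choice _ _ _ (m_Phi r) _ _ _
    (fun phi w => g phi (m_X r t w) (m_flow w))) => // phi.
  apply: (@measurable_disc_choice _ _ _ (m_X r t) _ _ _
    (fun x w => g phi x (m_flow w))) => // x.
  by apply: measurableT_comp => //; exact: measurable_m_flow.
transitivity (\int[P]_w
  (\sum_(t < T) gt t (m_Phi r w) (m_X r (now t) w) (m_flow w) +
   gT (m_Phi r w) (m_X r ord_max w) (m_flow w))).
  rewrite /mfg_cost_of unlock /Rintegral; congr fine.
  apply: eq_integral => w _; congr (_%:E); congr (_ + _).
    by apply: eq_bigr => t _; rewrite /gt tnth_mktuple.
  by rewrite /gT tnth_mktuple.
have intl t (g : strategy -> X -> flow R T X -> R) :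
    (forall phi x, measurable_fun setT (g phi x)) ->
    (forall phi x m, `|g phi x m| <= M) ->
    lam.-integrable setT (EFin \o (fun m => mean (kernel_mass m)
       (fun phi => mean (law m phi t) (fun x => g phi x m)))).
  move=> mg gM; apply: (@bounded_integrable _ _ _ _ _ M) => [|m].
    apply: measurable_sum => phi; apply: measurable_funM.
      exact: measurable_kernel_mass.
    apply: measurable_sum => x; apply: measurable_funM => //.
    exact: measurable_mf_law.
  have lw phi : is_weight (law m phi t).
    by apply: mf_law_weight; [exact: trans_weight|exact: fprob_weight].
  have kw := kernel_mass_weight m.
  apply: norm_mean_le kw _ => phi; exact: norm_mean_le.
have gtM t phi x m : `|gt t phi x m| <= M by exact: f_le.
have gTM phi x m : `|gT phi x m| <= M by exact: F_le.
have sum_int : P.-integrable setT (EFin \o (fun w =>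
    \sum_(t < T) gt t (m_Phi r w) (m_X r (now t) w) (m_flow w))).
  apply: (@eq_integrable _ _ _ _ _ measurableT (fun w => \sum_(t < T)
    (gt t (m_Phi r w) (m_X r (now t) w) (m_flow w))%:E)%E).
    by move=> w _ /=; rewrite sumEFin.
  by apply: integrable_sum => // t _; exact: (int (now t) (gt t)).
rewrite RintegralD//; last exact: (int ord_max gT).
rewrite Rintegral_sum; last by move=> t; exact: (int (now t) (gt t)).
rewrite (mfg_expectation ord_max mgT gTM).
under eq_bigr do rewrite (mfg_expectation _ (mgt _) (gtM _)).
rewrite -Rintegral_sum; last by move=> t; exact: (intl (now t) (gt t)).
rewrite -RintegralD//; last exact: (intl ord_max gT).
  by apply: eq_Rintegral => m _; rewrite -mean_sum -meanD.
apply: (@eq_integrable _ _ _ _ _ measurableT (fun m => \sum_(t < T)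
  (mean (kernel_mass m) (fun phi => mean (law m phi (now t))
     (fun x => gt t phi x m)))%:E)%E).
  by move=> m _ /=; rewrite sumEFin.
by apply: integrable_sum => // t _; exact: (intl (now t) (gt t)).
Qed.

End MFGRealization.

(** * Consistency as a fixed point equation *)

Section Consistency.
Variables (R : realType) (T : nat) (X Gam : pfinType).
Notation strategy := (strategy T X Gam).
Variable Psi : 'I_T -> disc X * fprob R X * disc Gam * noise R -> disc X.
Hypothesis Psi_meas : forall t, measurable_fun setT (Psi t).
Variables (m0 : fprob R X) (rho : probability (disc strategy * flow R T X)%type R).
Variable rho1 : R.-pker (flow R T X) ~> (disc strategy).
Hypothesis rho_factor : forall (C : set (disc strategy)) (B : set (flow R T X)),
  measurable B ->
  (rho (C `*` B) = \int[flow_marginal rho]_(m in B) rho1 m C)%E.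
Variable r : mfg_system R T X Gam.
Hypothesis real : is_mfg_realization Psi r id m0 rho.
Hypothesis cond : forall t : 'I_T.+1,
  regular_cond_dist (S := X) (m_P r) (@mu_sigma _ _ _ _ r) (m_X r t) (m_mu r t).

Let lam := flow_marginal rho.
Let P := m_P r.

(** It is enough to test the coordinates, which generate the sigma-algebra of the
    space of flows. *)
Lemma mu_sigma_flow D : measurable D -> mu_sigma (@m_flow _ _ _ _ r @^-1` D).
Proof.
move=> mD; suff : image_set_system setT (@m_flow _ _ _ _ r) (@mu_sigma _ _ _ _ r) D.
  by rewrite /image_set_system/= setTI.
apply: (smallest_sub _ _ mD).
  exact/sigma_algebra_image/smallest_sigma_algebra.
move=> E; rewrite -bigcup_seq => -[t _ [B mB <-]].
rewrite /image_set_system/= !setTI; apply: sub_sigma_algebra.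
exists t => //; exists B => //; rewrite setTI.
by apply/seteqP; split => w /=; rewrite tnth_mktuple.
Qed.

Lemma law_m_flow D : measurable D ->
  P (@m_flow _ _ _ _ r @^-1` D) = lam D.
Proof.
move=> mD; rewrite -[RHS](m_law_Phi_flow real (A := snd @^-1` D))//.
exact: (measurable_preim (Y := snd)).
Qed.

(** Both sides have the same integral over every event of the flow: the left one by
    the conditional distribution, the right one by the law of the realization. *)
Lemma consistency_ae : {ae lam, forall m : flow R T X, forall t x,
  tnth m t x = mean (kernel_mass rho1 m)
    (fun phi => mf_law (trans Psi) m0 m phi t x)}.
Proof.
apply: filter_forall => t; apply: filter_forall => x.
pose k m := mean (kernel_mass rho1 m) (fun phi => mf_law (trans Psi) m0 m phi t x).
have mk : measurable_fun setT k.
  apply: measurable_sum => phi; apply: measurable_funM.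
    exact: measurable_kernel_mass.
  exact: measurable_mf_law.
have joint1 m phi : `|mf_law (trans Psi) m0 m phi t x| <= 1.
  apply: normr_weight_le1; apply: mf_law_weight; last exact: fprob_weight.
  exact: trans_weight.
have k1 m : `|k m| <= 1.
  by apply: norm_mean_le; [exact: kernel_mass_weight|exact: joint1].
pose c (m : flow R T X) := tnth m t x.
have mc : measurable_fun setT c.
  apply: (measurableT_comp (f := fun mu : fprob R X => mu x)).
    exact: measurable_mass.
  exact: measurable_tnth.
have c1 m : `|c m| <= 1 by exact: normr_weight_le1 (fprob_weight _).
have ci := bounded_integrable lam mc c1.
have ki := bounded_integrable lam mk k1.
suff : ae_eq lam setT (EFin \o c) (EFin \o k).
  by apply: filterS => m /(_ I) [].
apply: integral_ae_eq => //; first exact/measurable_EFinP.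
move=> D _ mD; have mUD : measurable (@m_flow _ _ _ _ r @^-1` D).
  by apply: measurable_preim mD; exact: measurable_m_flow.
rewrite (integral_Rintegral mD ci) (integral_Rintegral mD ki).
have := (cond t [set x]%SET).2 _ (mu_sigma_flow mD).
rewrite (_ : [set` [set x]%SET] = [set x]); last first.
  by apply/seteqP; split => y /=; rewrite inE => /eqP.
under eq_integral do rewrite /prob big_set1.
have cU1 w : `|c (@m_flow _ _ _ _ r w)| <= 1 by exact: c1.
have mcU : measurable_fun setT (fun w => c (@m_flow _ _ _ _ r w)).
  by apply: measurableT_comp => //; exact: measurable_m_flow.
have -> : (\int[P]_(w in @m_flow _ _ _ _ r @^-1` D) (m_mu r t w x)%:E)%E =
    (\int[lam]_(m in D) c m)%:E.
  transitivity (\int[P]_(w in @m_flow _ _ _ _ r @^-1` D)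
      (c (@m_flow _ _ _ _ r w))%:E)%E.
    by apply: eq_integral => w _; rewrite /c tnth_mktuple.
  rewrite integral_Rintegral//; last exact: bounded_integrable cU1.
  congr (_%:E); rewrite [LHS]Rintegral_indicM [RHS]Rintegral_indicM.
  transitivity (\int[P]_w (c (@m_flow _ _ _ _ r w) *
      \1_D (@m_flow _ _ _ _ r w) * \1_[set: m_Omega r] w)).
    by apply: eq_Rintegral => w _; rewrite indicT mulr1.
  have cD1 m : `|c m * \1_D m| <= 1.
    by rewrite normrM mulr_ile1// indicE normr_nat lern1 leq_b1.
  rewrite (integral_event (P := P) (lam := lam) (U := @m_flow _ _ _ _ r)
    (k := fun=> 1) (M := 1) measurableT (measurable_m_flow (r := r)) _ _ _
    (g := fun m => c m * \1_D m) (Mg := 1)) //.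
  - by apply: eq_Rintegral => m _; rewrite mulr1.
  - by move=> m; rewrite normr1.
  - move=> D' mD'; rewrite setTI law_m_flow// -integral_Rintegral//.
      by rewrite integral_cst// mul1e.
    by apply: (@bounded_integrable _ _ _ _ _ 1) => // m; rewrite normr1.
  - by apply: measurable_funM => //; exact: measurable_indic.
move=> <-; rewrite (measure_split (Y := m_Phi r) _ P)//; last first.
  by apply: measurableI => //; exact: measurable_preim.
rewrite (_ : \int[lam]_(m in D) k m = \sum_phi \int[lam]_(m in D)
    (kernel_mass rho1 m phi * mf_law (trans Psi) m0 m phi t x)).
  rewrite -sumEFin; apply: eq_bigr => phi _.
  rewrite -(mfg_event_law Psi_meas rho_factor real phi t x mD); congr (P _).
  by apply/seteqP; split => w [[]] => [h1 h2 h3|h1 h2 h3]; split=> //; split.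
have int phi : lam.-integrable setT (EFin \o (fun m =>
    kernel_mass rho1 m phi * mf_law (trans Psi) m0 m phi t x)).
  apply: (@bounded_integrable _ _ _ _ _ 1) => [|m].
    apply: measurable_funM; first exact: measurable_kernel_mass.
    exact: measurable_mf_law.
  by rewrite normrM mulr_ile1//; exact: normr_weight_le1 (kernel_mass_weight _ _).
apply: EFin_inj; rewrite -(integral_Rintegral mD ki) -sumEFin.
under [LHS]eq_integral do rewrite /k /mean /= -sumEFin.
rewrite (integral_sum mD (fun phi => integrableS measurableT mD (@subsetT _ _) (int phi))).
by apply: eq_bigr => phi _; rewrite -integral_Rintegral.
Qed.

End Consistency.

(** * Existence of realizations *)

Section ProbabilityCopy.
Context d (T : measurableType d) (R : realType) (nu : {measure set T -> \bar R}).
Hypothesis nuT : nu setT = 1%E.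

(** The measure [nu] under a name that carries the proof that its mass is one. *)
Definition probability_copy : set T -> \bar R := let _ := nuT in nu.
HB.instance Definition _ := Measure.copy probability_copy nu.
HB.instance Definition _ :=
  Measure_isProbability.Build _ T R probability_copy nuT.

End ProbabilityCopy.

Section Construction.
Variable R : realType.

Definition to_mfun d1 d2 (S1 : measurableType d1) (S2 : measurableType d2)
    (h : S1 -> S2) (mh : measurable_fun setT h) : {mfun S1 >-> S2} :=
  HB.pack h (isMeasurableFun.Build _ _ S1 S2 h mh).

Lemma exists_fin_law (S : pfinType) (p : fprob R S) :
  exists Q : probability (disc S) R, forall A : {set S}, Q [set` A] = (prob p A)%:E.
Proof.
have [p0 p1] := fprob_weight p.
pose c (n : nat) : {nonneg R} := NngNum (p0 (nth point (enum S) n)).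
pose m_ (n : nat) : {measure set (disc S) -> \bar R} :=
  mscale (c n) (dirac (nth point (enum S) n : disc S)).
pose m : {measure set (disc S) -> \bar R} := msum m_ #|S|.
have mE (A : {set S}) : m [set` A] = (prob p A)%:E.
  have -> : prob p A = \sum_(s <- enum S) (if s \in A then p s else 0).
    by rewrite big_enum /prob big_mkcond.
  rewrite -sumEFin (big_nth point) -cardE big_mkord.
  rewrite /m /= /msum; apply: eq_bigr => n _.
  rewrite /= /mscale/= diracE; case: ifPn => [sA|sA].
    by rewrite mem_set// mule1.
  by rewrite memNset ?mule0// => h; move/negP: sA; apply.
have mT : m setT = 1%E.
  rewrite (_ : setT = [set` [set: S]%SET]) ?mE.
    by rewrite /prob (eq_bigl xpredT) ?p1// => s; rewrite inE.
  by apply/seteqP; split => s //=; rewrite inE.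
by exists (probability_copy mT).
Qed.

Lemma exists_iid_tuple d (S : measurableType d) (nu : probability S R) n :
  exists Q : probability (n.-tuple S) R, forall B : 'I_n -> set S,
    (forall i, measurable (B i)) ->
    Q (\bigcap_i (fun z => tnth z i) @^-1` B i) = (\prod_i fine (nu (B i)))%:E.
Proof.
elim: n => [|n [Q QE]].
  exists (dirac [tuple]) => B mB; rewrite big_ord0 /= diracE mem_set//.
  by move=> [].
pose h (z : S * n.-tuple S) := [tuple of z.1 :: z.2].
have mh : measurable_fun setT h by exact: measurable_cons.
pose Q' : probability (n.+1.-tuple S) R :=
  distribution (nu \x Q)%E (to_mfun mh).
exists Q' => B mB.
pose B1 i := B (lift ord0 i).
have E : h @^-1` (\bigcap_i (fun z => tnth z i) @^-1` B i) =
    B ord0 `*` \bigcap_i (fun z => tnth z i) @^-1` B1 i.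
  apply/seteqP; split => [[z1 z2] hz|[z1 z2] [/= h1 h2] i _].
    split=> /=; first by have := hz ord0 I; rewrite /= tnth0.
    by move=> i _; have := hz (lift ord0 i) I; rewrite /= tnthS.
  case: (unliftP ord0 i) => [j ->|->] /=; last by rewrite tnth0.
  by rewrite tnthS; exact: h2.
rewrite [LHS](_ : _ = (nu \x Q)%E (B ord0 `*`
    \bigcap_i (fun z => tnth z i) @^-1` B1 i)); last by rewrite -E.
rewrite product_measure1E//; last first.
  apply: fin_bigcap_measurable; first exact: finite_finset.
  move=> i _; apply: (measurable_preim (Y := fun z => tnth z i)).
    exact: measurable_tnth.
  exact: mB.
transitivity (nu (B ord0) * (\prod_i fine (nu (B1 i)))%:E)%E.
  by congr (_ * _)%E; apply: QE => i; exact: mB.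
by rewrite big_ord_recl EFinM fineK// fin_num_measure.
Qed.

Section Triple.
Context d1 d2 d3 (S1 : measurableType d1) (S2 : measurableType d2)
  (S3 : measurableType d3).
Variables (Q1 : probability S1 R) (Q2 : probability S2 R) (Q3 : probability S3 R).

Definition triple_product : probability (S1 * S2 * S3)%type R := ((Q1 \x Q2) \x Q3)%E.

Lemma tripleE A1 A2 A3 : measurable A1 -> measurable A2 -> measurable A3 ->
  triple_product (A1 `*` A2 `*` A3) = (Q1 A1 * Q2 A2 * Q3 A3)%E.
Proof.
move=> m1 m2 m3; rewrite /triple_product/= product_measure1E//; last exact: measurableX.
by congr (_ * _)%E; exact: product_measure1E.
Qed.

Lemma triple1 A : measurable A -> triple_product ((fun w => w.1.1) @^-1` A) = Q1 A.
Proof.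
move=> mA; rewrite -[RHS]mule1 -[RHS]mule1 -[X in (_ * X * _)%E](probability_setT Q2).
rewrite -[X in (_ * _ * X)%E](probability_setT Q3) -tripleE//.
by congr (triple_product _); apply/seteqP; split => // w [[]].
Qed.

Lemma triple2 A : measurable A -> triple_product ((fun w => w.1.2) @^-1` A) = Q2 A.
Proof.
move=> mA; rewrite -[RHS]mul1e -[RHS]mule1 -[X in (X * _ * _)%E](probability_setT Q1).
rewrite -[X in (_ * _ * X)%E](probability_setT Q3) -tripleE//.
by congr (triple_product _); apply/seteqP; split => // w [[]].
Qed.

Lemma triple3 A : measurable A -> triple_product (snd @^-1` A) = Q3 A.
Proof.
move=> mA; rewrite -[RHS]mul1e -[X in (X * _)%E]mule1.
rewrite -[X in (X * _ * _)%E](probability_setT Q1).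
rewrite -[X in (_ * X * _)%E](probability_setT Q2) -tripleE//.
by congr (triple_product _); apply/seteqP; split => // w [[]].
Qed.

Lemma triple_independent d (S : measurableType d) (h : S3 -> S) :
  measurable_fun setT h ->
  independent3 triple_product (fun w => h w.2) (fun w => w.1.1) (fun w => w.1.2).
Proof.
move=> mh A3 A1 A2 m3 m1 m2.
have mh3 : measurable (h @^-1` A3) by exact: measurable_preim.
rewrite (triple1 m1) (triple2 m2) (triple3 mh3) -muleA muleC -tripleE//.
by congr (triple_product _); apply/seteqP; split => w; [move=> [[? ?] ?]|move=> [[? ?] ?]].
Qed.

End Triple.
End Construction.

Section IidCoordinates.
Variable R : realType.
Context d1 d2 d (S1 : measurableType d1) (S2 : measurableType d2)
  (S : measurableType d) (I : finType).
Variables (Q1 : probability S1 R) (Q2 : probability S2 R) (nu : probability S R).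
Variable Q3 : probability (#|I|.-tuple S) R.
Hypothesis Q3E : forall B : 'I_#|I| -> set S, (forall i, measurable (B i)) ->
  Q3 (\bigcap_i (fun z => tnth z i) @^-1` B i) = (\prod_i fine (nu (B i)))%:E.

Definition coordinate (i : I) (w : S1 * S2 * #|I|.-tuple S) : S :=
  tnth w.2 (enum_rank i).

Lemma measurable_coordinate i : measurable_fun setT (coordinate i).
Proof.
apply: (measurableT_comp (f := fun z => tnth z (enum_rank i))) => //.
exact: measurable_tnth.
Qed.

Let capE (A : I -> set S) : (forall i, measurable (A i)) ->
  triple_product Q1 Q2 Q3 (\bigcap_i coordinate i @^-1` A i) =
  (\prod_i fine (nu (A i)))%:E.
Proof.
move=> mA; pose B (k : 'I_#|I|) := A (enum_val k).
have -> : \bigcap_i coordinate i @^-1` A i =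
    snd @^-1` (\bigcap_k (fun z => tnth z k) @^-1` B k).
  apply/seteqP; split => [w h k _|w h i _] /=.
    by have := h (enum_val k) Logic.I; rewrite /= /coordinate enum_valK.
  by have := h (enum_rank i) Logic.I; rewrite /= /B enum_rankK.
rewrite triple3; last first.
  apply: fin_bigcap_measurable; first exact: finite_finset.
  move=> k _; apply: (measurable_preim (Y := fun z => tnth z k)).
    exact: measurable_tnth.
  exact: mA.
rewrite Q3E => [|k]; last exact: mA.
by rewrite [in RHS](reindex _ (onW_bij _ (@enum_val_bij I))).
Qed.

Lemma iid_coordinate : iid (triple_product Q1 Q2 Q3) coordinate nu.
Proof.
have one i A : measurable A -> triple_product Q1 Q2 Q3 (coordinate i @^-1` A) = nu A.
  move=> mA; pose B j := if j == i then A else setT.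
  have mB j : measurable (B j) by rewrite /B; case: ifP.
  transitivity (triple_product Q1 Q2 Q3 (\bigcap_j coordinate j @^-1` B j)).
    congr (triple_product _ _ _ _); apply/seteqP; split => w h.
      by move=> j _; rewrite /B/=; case: eqP => // ->.
    by have := h i Logic.I; rewrite /B/= eqxx.
  rewrite capE// (bigD1 i)//= big1 ?mulr1 => [|j /negbTE ji].
    by rewrite /B eqxx fineK// fin_num_measure.
  by rewrite /B ji probability_setT.
split=> // A mA; rewrite capE//; congr (_%:E); apply: eq_bigr => i _.
by rewrite one.
Qed.

End IidCoordinates.

Section GameExistence.
Variables (R : realType) (T : nat) (X Gam : pfinType).
Notation strategy := (strategy T X Gam).
Variable Psi : 'I_T -> disc X * fprob R X * disc Gam * noise R -> disc X.
Hypothesis Psi_meas : forall t, measurable_fun setT (Psi t).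
Variables (N : nat) (hN : (1 < N)%N).
Variables (u : strategy -> strategy) (i : 'I_N).
Variables (mN : fprob R {ffun 'I_N -> X}) (gam : fprob R {ffun 'I_N -> strategy}).

(** On a product space carrying initial states, profile and noises, the dynamics is
    solved forward in time. *)
Lemma exists_game_realization :
  exists r : game_system R T X Gam N, is_game_realization Psi hN r u i mN gam.
Proof.
have [Q1 Q1E] := exists_fin_law mN; have [Q2 Q2E] := exists_fin_law gam.
have [Q3 Q3E] := exists_iid_tuple (unif R) #|{: 'I_N * 'I_T}|.
pose Omega := (disc {ffun 'I_N -> X} * disc {ffun 'I_N -> strategy} *
  #|{: 'I_N * 'I_T}|.-tuple (noise R))%type.
pose xi js (w : Omega) := coordinate js w.
have mxi js : measurable_fun setT (xi js) by exact: measurable_coordinate.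
pose Phi j (w : Omega) : disc strategy := (w.1.2 : {ffun 'I_N -> strategy}) j.
have mPhi j : measurable_fun setT (Phi j).
  apply: (measurableT_comp (f := fun phi : disc {ffun 'I_N -> strategy} =>
    (phi : {ffun 'I_N -> strategy}) j : disc strategy)) => //.
  by apply: measurableT_comp.
pose step (t : 'I_T) (Y : Omega -> disc {ffun 'I_N -> X}) (w : Omega) :
    disc {ffun 'I_N -> X} :=
  [ffun j => Psi t ((Y w : {ffun 'I_N -> X}) j,
     empirical R hN (Y w : {ffun 'I_N -> X}) j,
     deviate u i w.1.2 j (t, (Y w : {ffun 'I_N -> X}) j), xi (j, t) w) : X].
pose Y := evolve step (fun w => w.1.1).
have mY t : measurable_fun setT (Y t).
  elim/time_ind: t => [|t IH]; first by apply: measurableT_comp.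
  rewrite /Y evolveS -/Y.
  pose Z w : disc ({ffun 'I_N -> X} * {ffun 'I_N -> strategy})%type :=
    (Y (now t) w, w.1.2).
  have mZ : measurable_fun setT Z.
    by apply: measurable_disc_pair => //; apply: measurableT_comp.
  apply: (@measurable_disc_choice _ _ _ Z mZ _ _ (fun s w =>
    [ffun j => Psi t (s.1 j, empirical R hN s.1 j,
      deviate u i s.2 j (t, s.1 j), xi (j, t) w) : X]
      : disc {ffun 'I_N -> X})) => -[x phi].
  apply: measurable_disc_ffun => j; exact: measurable_Psi_section.
pose Xs j t (w : Omega) : disc X := (Y t w : {ffun 'I_N -> X}) j.
have mX j t : measurable_fun setT (Xs j t).
  exact: (measurableT_comp (f := fun x : disc {ffun 'I_N -> X} =>
    (x : {ffun 'I_N -> X}) j : disc X)).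
pose r : game_system R T X Gam N :=
  @GameSystem R T X Gam N _ _ (triple_product Q1 Q2 Q3) (fun j => to_mfun (mPhi j))
    (fun j t => to_mfun (mX j t)) (fun js => to_mfun (mxi js)).
have X0E : @g_X0 _ _ _ _ _ r = (fun w => w.1.1).
  by apply/funext => w; apply/ffunP => j; rewrite ffunE.
have profE : @g_profile _ _ _ _ _ r = (fun w => w.1.2).
  by apply/funext => w; apply/ffunP => j; rewrite ffunE.
exists r; split.
- by move=> A; rewrite X0E -Q1E; exact: triple1.
- by move=> A; rewrite profE -Q2E; exact: triple2.
- exact: iid_coordinate.
- rewrite X0E profE.
  pose h (z : #|{: 'I_N * 'I_T}|.-tuple (noise R)) :=
    [tuple [tuple tnth z (enum_rank (j, t)) | t < T] | j < N].
  apply: (@triple_independent _ _ _ _ _ _ _ Q1 Q2 Q3 _ _ h).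
  apply/measurable_fun_tnthP => j; apply/measurable_fun_tnthP => t.
  rewrite (_ : _ \o _ = fun z => tnth z (enum_rank (j, t))).
    exact: measurable_tnth.
  by apply/funext => z; rewrite /h /= !tnth_mktuple.
- apply: aeW => w t j /=.
  rewrite /Xs /Y evolveS -/Y [LHS]ffunE; congr (Psi t (_, _, _, _)).
  by rewrite /g_action [deviate _ _ _ _]ffunE; case: ifP.
Qed.

Variables (f : 'I_T -> disc X * fprob R X * disc Gam -> R)
  (F : disc X * fprob R X -> R).

Lemma game_costE : game_cost Psi f F hN mN gam u i =
  mean gam (fun phi =>
    profile_cost (trans Psi) f F hN mN (deviate u i phi) i).
Proof.
have [r hr] := exists_game_realization.
have : exists c, [set c | exists2 r : game_system R T X Gam N,
    is_game_realization Psi hN r u i mN gam & c = game_cost_of f F hN r u i] c.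
  by exists (game_cost_of f F hN r u i); exists r.
move=> /(xgetPex 0)[r' hr']; rewrite /game_cost => ->.
exact: game_cost_of_realization.
Qed.

End GameExistence.

Section MFGExistence.
Variables (R : realType) (T : nat) (X Gam : pfinType).
Notation strategy := (strategy T X Gam).
Variable Psi : 'I_T -> disc X * fprob R X * disc Gam * noise R -> disc X.
Hypothesis Psi_meas : forall t, measurable_fun setT (Psi t).
Variables (m0 : fprob R X) (rho : probability (disc strategy * flow R T X)%type R).
Variable u : strategy -> strategy.

Lemma exists_mfg_realization :
  exists r : mfg_system R T X Gam, is_mfg_realization Psi r u m0 rho.
Proof.
have [Q1 Q1E] := exists_fin_law m0.
have [Q3 Q3E] := exists_iid_tuple (unif R) #|'I_T|.
pose Omega := (disc X * (disc strategy * flow R T X) *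
  #|'I_T|.-tuple (noise R))%type.
pose xi s (w : Omega) := coordinate s w.
have mxi s : measurable_fun setT (xi s) by exact: measurable_coordinate.
pose Phi (w : Omega) : disc strategy := w.1.2.1.
have mPhi : measurable_fun setT Phi.
  by apply: measurableT_comp => //; apply: measurableT_comp.
pose mu t (w : Omega) := tnth w.1.2.2 t.
have mmu t : measurable_fun setT (mu t).
  apply: (measurableT_comp (f := fun m : flow R T X => tnth m t)).
    exact: measurable_tnth.
  by apply: measurableT_comp => //; apply: measurableT_comp.
pose step (t : 'I_T) (Y : Omega -> disc X) (w : Omega) : disc X :=
  Psi t (Y w, mu (now t) w, u (Phi w) (t, Y w), xi t w).
pose Y := evolve step (fun w => w.1.1).
have mY t : measurable_fun setT (Y t).
  elim/time_ind: t => [|t IH]; first by apply: measurableT_comp.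
  rewrite /Y evolveS -/Y.
  pose Z w : disc (X * strategy)%type := (Y (now t) w, Phi w).
  have mZ : measurable_fun setT Z by exact: measurable_disc_pair.
  apply: (@measurable_disc_choice _ _ _ Z mZ _ _ (fun s w =>
    Psi t (s.1, mu (now t) w, u s.2 (t, s.1), xi t w))) => -[x phi].
  exact: measurable_Psi_section.
pose r : mfg_system R T X Gam :=
  @MFGSystem R T X Gam _ _ (triple_product Q1 rho Q3) (to_mfun mPhi)
    (fun t => to_mfun (mY t)) (fun t => to_mfun (mmu t))
    (fun s => to_mfun (mxi s)).
have PhiE : @m_Phi_flow _ _ _ _ r = (fun w => w.1.2).
  apply/funext => -[[x [phi m]] z]; rewrite /m_Phi_flow; congr pair.
  by apply: eq_from_tnth => t; rewrite tnth_mktuple.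
exists r; split.
- by move=> A; rewrite -Q1E; exact: triple1.
- by move=> A mA; rewrite PhiE; exact: triple2.
- exact: iid_coordinate.
- rewrite PhiE.
  pose h (z : #|'I_T|.-tuple (noise R)) := [tuple tnth z (enum_rank s) | s < T].
  apply: (@triple_independent _ _ _ _ _ _ _ Q1 rho Q3 _ _ h).
  apply/measurable_fun_tnthP => s.
  rewrite (_ : _ \o _ = fun z => tnth z (enum_rank s)).
    exact: measurable_tnth.
  by apply/funext => z; rewrite /h /= tnth_mktuple.
- by apply: aeW => w t /=; rewrite /Y evolveS.
Qed.

Variable rho1 : R.-pker (flow R T X) ~> (disc strategy).
Hypothesis rho_factor : forall (C : set (disc strategy)) (B : set (flow R T X)),
  measurable B ->
  (rho (C `*` B) = \int[flow_marginal rho]_(m in B) rho1 m C)%E.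
Variable f : 'I_T -> disc X * fprob R X * disc Gam -> R.
Variable F : disc X * fprob R X -> R.
Hypotheses (f_meas : forall t, measurable_fun setT (f t))
  (F_meas : measurable_fun setT F).
Variable M : R.
Hypotheses (f_le : forall t y, `|f t y| <= M) (F_le : forall y, `|F y| <= M).

Lemma mfg_costE : mfg_cost Psi f F m0 rho u =
  \int[flow_marginal rho]_m mean (kernel_mass rho1 m)
    (fun phi => mf_cost (trans Psi) f F m0 m (u phi)).
Proof.
have [r hr] := exists_mfg_realization.
have : exists c, [set c | exists2 r : mfg_system R T X Gam,
    is_mfg_realization Psi r u m0 rho & c = mfg_cost_of f F r u] c.
  by exists (mfg_cost_of f F r u); exists r.
move=> /(xgetPex 0)[r' hr']; rewrite /mfg_cost => ->.
exact: (mfg_cost_of_realization Psi_meas rho_factor hr' f_meas F_meas f_le F_le).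
Qed.

End MFGExistence.

(** * Approximate equilibria *)

Section Approximation.
Variables (R : realType) (T : nat) (X Gam : pfinType).
Notation strategy := (strategy T X Gam).
Variable Psi : 'I_T -> disc X * fprob R X * disc Gam * noise R -> disc X.
Hypothesis Psi_meas : forall t, measurable_fun setT (Psi t).
Variables (m0 : fprob R X) (rho : probability (disc strategy * flow R T X)%type R).
Variable rho1 : R.-pker (flow R T X) ~> (disc strategy).
Variable f : 'I_T -> disc X * fprob R X * disc Gam -> R.
Variable F : disc X * fprob R X -> R.
Hypotheses (f_meas : forall t, measurable_fun setT (f t))
  (F_meas : measurable_fun setT F).
Variable M : R.
Hypotheses (f_le : forall t y, `|f t y| <= M) (F_le : forall y, `|F y| <= M).

Let lam := flow_marginal rho.
Definition draws (m : flow R T X) (N : nat) : {ffun 'I_N -> strategy} -> R :=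
  prodw (fun=> kernel_mass rho1 m).
Arguments draws : clear implicits.

Lemma draws_weight m N : is_weight (draws m N).
Proof. by apply: prodw_weight => _; exact: kernel_mass_weight. Qed.

Lemma measurable_draws N phi : measurable_fun setT (fun m => draws m N phi).
Proof.
apply: measurable_prod => j _; exact: measurable_kernel_mass.
Qed.

(** Product events determine the law of the profile: singletons are such events. *)
Lemma mixture_mean N (gam : fprob R {ffun 'I_N -> strategy})
    (h : {ffun 'I_N -> strategy} -> R) :
  (forall C : 'I_N -> {set strategy},
    (prob gam
      [set c : {ffun 'I_N -> strategy} | [forall i, c i \in C i]]%SET)%:E =
    (\int[lam]_m (\prod_(i < N) fine (rho1 m [set` C i]))%:E)%E) ->
  mean gam h = \int[lam]_m mean (draws m N) h.
Proof.
move=> gam_def; have pint phi : lam.-integrable setT (EFin \o (fun m => draws m N phi)).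
  apply: (@bounded_integrable _ _ _ _ _ 1); first exact: measurable_draws.
  by move=> m; exact: normr_weight_le1 (draws_weight m N).
have gamE phi : gam phi = \int[lam]_m draws m N phi.
  apply: EFin_inj; rewrite -integral_Rintegral//.
  transitivity (prob gam [set c : {ffun 'I_N -> strategy} |
      [forall i, c i \in [set phi i]]]%SET)%:E.
    congr (_%:E); rewrite /prob (big_pred1 phi)// => c; rewrite inE.
    apply/forallP/eqP => [h'|-> j]; last by rewrite inE.
    by apply/ffunP => j; have := h' j; rewrite inE => /eqP.
  rewrite (gam_def (fun i => [set phi i]%SET)).
  apply: eq_integral => m _; congr (_%:E); apply: eq_bigr => j _.
  rewrite /kernel_mass; congr (fine (rho1 m _)).
  by apply/seteqP; split => c /=; rewrite inE => /eqP.
rewrite /mean Rintegral_sum => [|phi]; last first.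
  apply: (@bounded_integrable _ _ _ _ _ `|h phi|) => [|m].
    by apply: measurable_funM => //; exact: measurable_draws.
  by rewrite normrM ler_piMl//; exact: normr_weight_le1 (draws_weight m N).
by apply: eq_bigr => phi _; rewrite RintegralZr// gamE.
Qed.

Lemma normr_profile_cost N (hN : (1 < N)%N) w0 psi i : is_weight w0 ->
  `|profile_cost (trans Psi) f F hN w0 psi i| <= T%:R * M + M.
Proof.
move=> hw0; have lw t : is_weight (game_law (trans Psi) hN w0 psi t).
  by apply: game_law_weight => // *; exact: trans_weight.
apply: le_trans (ler_normD _ _) _; apply: lerD; last exact: norm_mean_le.
apply: le_trans (ler_norm_sum _ _ _) _.
rewrite mulr_natl -[T in leRHS]card_ord -sumr_const; apply: ler_sum => t _.
exact: norm_mean_le.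
Qed.

Definition limit_cost (u : strategy -> strategy) (m : flow R T X) : R :=
  mean (kernel_mass rho1 m) (fun phi => mf_cost (trans Psi) f F m0 m (u phi)).

Definition finite_cost (m0N : nat -> fprob R X) n
    (p : 'I_n.+2 * {ffun strategy -> strategy}) (m : flow R T X) : R :=
  mean (draws m n.+2) (fun phi => profile_cost (trans Psi) f F (N := n.+2) isT
    (prodw (fun=> m0N n.+2)) (deviate p.2 p.1 phi) p.1).

(** The maximum makes the estimate uniform in the player and in the modification;
    the latter ranges over finite functions, since a maximum needs a finite type. *)
Definition max_gap m0N n m : R :=
  \big[Num.max/0]_(p : 'I_n.+2 * {ffun strategy -> strategy})
    `|finite_cost m0N p m - limit_cost p.2 m|.

Arguments max_gap : clear implicits.

Lemma measurable_limit_cost u : measurable_fun setT (limit_cost u).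
Proof.
apply: measurable_sum => phi; apply: measurable_funM.
  exact: measurable_kernel_mass.
exact: measurable_mf_cost.
Qed.

Lemma measurable_finite_cost m0N n p : measurable_fun setT (@finite_cost m0N n p).
Proof.
by apply: measurable_sum => phi; apply: measurable_funM => //; exact: measurable_draws.
Qed.

Let C := T%:R * M + M.

Lemma normr_limit_cost u m : `|limit_cost u m| <= C.
Proof.
apply: norm_mean_le; first exact: kernel_mass_weight.
by move=> phi; exact: normr_mf_cost.
Qed.

Lemma normr_finite_cost m0N n p m : `|@finite_cost m0N n p m| <= C.
Proof.
apply: norm_mean_le; first exact: draws_weight.
move=> phi; apply: normr_profile_cost; apply: prodw_weight => _.
exact: fprob_weight.
Qed.

Lemma measurable_max_gap m0N n : measurable_fun setT (max_gap m0N n).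
Proof.
rewrite /max_gap; elim: (index_enum _) => [|p s IH].
  by under eq_fun do rewrite big_nil; exact: measurable_cst.
under eq_fun do rewrite big_cons.
apply: measurable_maxr => //; apply: measurableT_comp => //.
apply: measurable_funB; first exact: measurable_finite_cost.
exact: measurable_limit_cost.
Qed.

Lemma max_gap_ge0 m0N n m : 0 <= max_gap m0N n m.
Proof. by apply: (big_ind (fun y => 0 <= y)) => // y z y0 _; rewrite le_max y0. Qed.

Lemma max_gap_le m0N n m : `|max_gap m0N n m| <= C + C.
Proof.
have C0 : 0 <= C by apply: le_trans (normr_limit_cost id point).
rewrite ger0_norm ?max_gap_ge0//; apply: bigmax_le => [|p _]; first exact: addr_ge0.
apply: le_trans (ler_normB _ _) _; apply: lerD; first exact: normr_finite_cost.
exact: normr_limit_cost.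
Qed.

Lemma le_max_gap m0N n (p : 'I_n.+2 * {ffun strategy -> strategy}) m :
  `|finite_cost m0N p m - limit_cost p.2 m| <= max_gap m0N n m.
Proof. exact: (le_bigmax _
  (fun p : 'I_n.+2 * {ffun strategy -> strategy} =>
     `|finite_cost m0N p m - limit_cost p.2 m|)). Qed.

Variable m0N : nat -> fprob R X.
Hypothesis m0N_cvg : m0N n @[n --> \oo] --> m0.
Hypothesis p_modulus : forall t x a y (m : fprob R X), controlled
  (fun mu => `|trans Psi t x mu a y - trans Psi t x m a y|)
  (fun mu => dist mu m).
Hypothesis A2_f : forall t, continuous (f t).
Hypothesis A2_F : continuous F.

Lemma cvg_initial_rate : initial_rate m0 m0N n @[n --> \oo] --> (0 : R).
Proof.
rewrite -[0]addr0; apply: cvgD.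
  have := @cvg_harmonic R; rewrite -cvg_shiftS; exact.
have := cvg_dist m0N_cvg; rewrite -(cvg_shiftn 2).
by under eq_fun do rewrite addn2.
Qed.

(** For a flow that solves the fixed point equation, propagation of chaos applies
    with [q = kernel_mass rho1 m]. *)
Lemma cvg_max_gap (m : flow R T X) :
  (forall t x, tnth m t x =
     mean (kernel_mass rho1 m) (fun phi => mf_law (trans Psi) m0 m phi t x)) ->
  max_gap m0N n m @[n --> \oo] --> (0 : R).
Proof.
move=> m_cons.
have pairx (x : X) : continuous (fun mu : fprob R X => (x : disc X, mu)).
  move=> mu; have FF : Filter (nbhs mu) by exact: nbhs_filter.
  have xx : (fun _ : fprob R X => (x : disc X)) @ mu --> (x : disc X).
    by apply: cvg_cst; exact: nbhs_filter.
  have mumu : (fun nu : fprob R X => nu) @ mu --> mu by apply: cvg_id.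
  exact: cvg_pair xx mumu.
have f_modulus t x a : controlled
    (fun mu => `|f t (x, mu, a) - f t (x, tnth m (now t), a)|)
    (fun mu => dist mu (tnth m (now t))).
  apply: (controlled_continuous (h := fun mu => f t (x, mu, a)) (M := M)) => //.
  apply: (@continuous_comp _ _ _
    (fun mu : fprob R X => (x : disc X, mu, a : disc Gam)) (f t)); last exact: A2_f.
  have FF : Filter (nbhs (tnth m (now t))) by exact: nbhs_filter.
  have aa : (fun _ : fprob R X => (a : disc Gam)) @ tnth m (now t) -->
      (a : disc Gam) by apply: cvg_cst; exact: nbhs_filter.
  exact: cvg_pair (pairx x (tnth m (now t))) aa.
have F_modulus x : controlled
    (fun mu => `|F (x, mu) - F (x, tnth m ord_max)|)
    (fun mu => dist mu (tnth m ord_max)).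
  apply: (controlled_continuous (h := fun mu => F (x, mu)) (M := M)) => //.
  apply: (@continuous_comp _ _ _ (fun mu : fprob R X => (x : disc X, mu)) F).
    exact: pairx.
  exact: A2_F.
have gap := controlled_deviated_cost (trans_weight Psi_meas) m0N
  (kernel_mass_weight rho1 m) m_cons
  (fun t x a y => p_modulus t x a y (tnth m (now t))) f_modulus F_modulus.
apply/cvgrPdist_le => e e0; have [c c0 hc] := gap _ (divr_gt0 e0 (ltr0Sn R 1)).
have rate0 : c * initial_rate m0 m0N n @[n --> \oo] --> (0 : R).
  by rewrite -(mulr0 c); apply: cvgM; [exact: cvg_cst|exact: cvg_initial_rate].
have /cvgrPdist_le/(_ _ (divr_gt0 e0 (ltr0Sn R 1))) := rate0.
apply: filterS => n; rewrite !sub0r !normrN => hn.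
rewrite ger0_norm ?max_gap_ge0//; apply: bigmax_le => [|[i u] _]; first exact: ltW.
apply: le_trans (hc (existT _ n (i, u : strategy -> strategy))) _ => /=.
rewrite [leRHS]splitr lerD2l; apply: le_trans hn; exact: ler_norm.
Qed.

Lemma cvg_integral_max_gap :
  {ae lam, forall m : flow R T X, forall t x, tnth m t x =
     mean (kernel_mass rho1 m) (fun phi => mf_law (trans Psi) m0 m phi t x)} ->
  \int[lam]_m max_gap m0N n m @[n --> \oo] --> (0 : R).
Proof.
move=> cons.
have mgap n : measurable_fun setT (EFin \o max_gap m0N n).
  by apply/measurable_EFinP; exact: measurable_max_gap.
have cint : lam.-integrable setT (EFin \o (fun=> C + C)).
  by apply: (@bounded_integrable _ _ _ _ _ `|C + C|).
have cv : {ae lam, forall m, setT m ->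
    (EFin \o max_gap m0N n) m @[n --> \oo] --> (0 : \bar R)}.
  apply: filterS cons => m /cvg_max_gap gap0 _.
  by apply: cvg_EFin; [exact: nearW|exact: gap0].
have bound : {ae lam, forall m n, setT m ->
    (`|(EFin \o max_gap m0N n) m| <= (C + C)%:E)%E}.
  by apply: aeW => m n _ /=; rewrite lee_fin max_gap_le.
have [_ _] := dominated_convergence measurableT mgap (measurable_cst _) cv cint bound.
rewrite integral0 => /fine_cvg; exact.
Qed.

End Approximation.

(** Both costs are integrals over the flow, whose integrands differ by at most
    [max_gap]. *)
Lemma game_cost_gap (R : realType) (T : nat) (X Gam : pfinType)
    (Psi : 'I_T -> disc X * fprob R X * disc Gam * noise R -> disc X)
    (f : 'I_T -> disc X * fprob R X * disc Gam -> R)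
    (F : disc X * fprob R X -> R) (M : R)
    (Psi_meas : forall t, measurable_fun setT (Psi t))
    (f_meas : forall t, measurable_fun setT (f t))
    (F_meas : measurable_fun setT F)
    (f_le : forall t y, `|f t y| <= M) (F_le : forall y, `|F y| <= M)
    (m0 : fprob R X) (m0N : nat -> fprob R X)
    (rho : probability (disc (strategy T X Gam) * flow R T X)%type R)
    (rho1 : R.-pker (flow R T X) ~> (disc (strategy T X Gam)))
    (rho_factor : forall (C : set (disc (strategy T X Gam))) (B : set (flow R T X)),
      measurable B ->
      (rho (C `*` B) = \int[flow_marginal rho]_(m in B) rho1 m C)%E)
    n (gam : fprob R {ffun 'I_n.+2 -> strategy T X Gam})
    (gam_def : forall C : 'I_n.+2 -> {set strategy T X Gam},
      (prob gam
         [set c : {ffun 'I_n.+2 -> strategy T X Gam} | [forall i, c i \in C i]]%SET)%:E =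
      (\int[flow_marginal rho]_m
         (\prod_(i < n.+2) fine (rho1 m [set` C i]))%:E)%E)
    (hN : (1 < n.+2)%N) (u : strategy T X Gam -> strategy T X Gam) (i : 'I_n.+2) :
  `|game_cost Psi f F hN (prod_fprob n.+2 (m0N n.+2)) gam u i -
    mfg_cost Psi f F m0 rho u| <=
  \int[flow_marginal rho]_m max_gap Psi m0 rho1 f F m0N n m.
Proof.
set lam := flow_marginal rho.
rewrite game_costE// (mfg_costE Psi_meas m0 u rho_factor f_meas F_meas f_le F_le).
rewrite (mixture_mean _ gam_def).
pose p : 'I_n.+2 * {ffun strategy T X Gam -> strategy T X Gam} := (i, finfun u).
have uE : p.2 = u :> (_ -> _) by apply/funext => phi; rewrite ffunE.
have hNE : hN = isT by exact: eq_irrelevance.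
have w0E : (prod_fprob n.+2 (m0N n.+2) : _ -> R) = prodw (fun=> m0N n.+2).
  by apply/funext => x; rewrite ffunE.
have finE m : mean (@draws _ _ _ _ rho1 m n.+2) (fun phi => profile_cost (trans Psi) f F hN
    (prod_fprob n.+2 (m0N n.+2)) (deviate u i phi) i) =
    finite_cost Psi rho1 f F m0N p m.
  by rewrite hNE w0E -uE.
under eq_Rintegral do rewrite finE.
have fin_int : lam.-integrable setT
    (EFin \o finite_cost Psi rho1 f F m0N p).
  apply: bounded_integrable; first exact: measurable_finite_cost.
  by move=> m; exact: (normr_finite_cost Psi_meas rho1 f_le F_le).
have lim_int : lam.-integrable setT (EFin \o limit_cost Psi m0 rho1 f F u).
  apply: bounded_integrable; first exact: measurable_limit_cost.
  by move=> m; exact: (normr_limit_cost Psi_meas m0 rho1 f_le F_le).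
have gap_int : lam.-integrable setT (EFin \o max_gap Psi m0 rho1 f F m0N n).
  apply: bounded_integrable; first exact: measurable_max_gap.
  by move=> m; exact: (max_gap_le Psi_meas m0 rho1 f_le F_le).
rewrite -RintegralB//.
have diff_int := integrableB measurableT fin_int lim_int.
apply: le_trans (le_normr_Rintegral measurableT diff_int) _.
apply: le_Rintegral => //.
  exact: (integrable_norm diff_int).
by move=> m _; have := le_max_gap Psi m0 rho1 f F m0N p m; rewrite uE.
Qed.

Theorem theorem7p1 (R : realType) (T : nat) (X Gam : pfinType)
    (Psi : 'I_T -> disc X * fprob R X * disc Gam * noise R -> disc X)
    (f : 'I_T -> disc X * fprob R X * disc Gam -> R)
    (F : disc X * fprob R X -> R)
    (Psi_meas : forall t, measurable_fun setT (Psi t))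
    (f_meas : forall t, measurable_fun setT (f t))
    (f_bounded : exists M : R, forall t y, `|f t y| <= M)
    (F_meas : measurable_fun setT F)
    (F_bounded : exists M : R, forall y, `|F y| <= M)
    (m0 : fprob R X) (m0N : nat -> fprob R X)
    (m0N_cvg : m0N n @[n --> \oo] --> m0)
    (A1_modulus : exists w : R -> R,
      [/\ measurable_fun (`[0, +oo[%classic : set R) w,
          (forall s, 0 <= s -> 0 <= w s <= 1),
          w s @[s --> 0^'+] --> (0 : R) &
          forall (t : 'I_T) (x : X) (a : Gam) (m m' : fprob R X),
            (\int[unif R]_z
               (\1_[set z | Psi t (x, m, a, z) <> Psi t (x, m', a, z)] z)%:E
             <= (w (dist m m'))%:E)%E])
    (A1_continuous : forall (t : 'I_T)
      (tau : probability (disc X * fprob R X * disc Gam)%type R),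
      {ae (tau \x unif R)%E, forall y, {for y, continuous (Psi t)}})
    (A2_f : forall t, continuous (f t))
    (A2_F : continuous F)
    (rho : probability (disc (strategy T X Gam) * flow R T X)%type R)
    (rho_solution : correlated_solution Psi f F m0 rho)
    (rho1 : R.-pker (flow R T X) ~> (disc (strategy T X Gam)))
    (rho_factor : forall (C : set (disc (strategy T X Gam))) (B : set (flow R T X)),
      measurable B ->
      (rho (C `*` B) = \int[flow_marginal rho]_(m in B) rho1 m C)%E)
    (gam : forall N, fprob R {ffun 'I_N -> strategy T X Gam})
    (gam_def : forall N, (1 < N)%N ->
      forall C : 'I_N -> {set strategy T X Gam},
      (prob (gam N)
         [set c : {ffun 'I_N -> strategy T X Gam} | [forall i, c i \in C i]]%SET)%:E =
      (\int[flow_marginal rho]_m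
         (\prod_(i < N) fine (rho1 m [set` C i]))%:E)%E) :
  exists eps : nat -> R,
    [/\ (forall N, 0 <= eps N),
        (forall (N : nat) (hN : (1 < N)%N),
           correlated_equilibrium Psi f F hN (eps N)
             (prod_fprob N (m0N N)) (gam N)) &
        eps n @[n --> \oo] --> (0 : R)].
Proof.
have [w [_ w01 w0 A1]] := A1_modulus.
have [M1 f_le1] := f_bounded; have [M2 F_le1] := F_bounded.
pose M := Num.max M1 M2.
have f_le t y : `|f t y| <= M by apply: le_trans (f_le1 t y) _; rewrite le_max lexx.
have F_le y : `|F y| <= M by apply: le_trans (F_le1 y) _; rewrite le_max lexx orbT.
have p_modulus t x a y m := trans_modulus Psi_meas t x a y m w01 w0 A1.
have [r real] := exists_mfg_realization Psi_meas m0 rho id.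
have cons := consistency_ae Psi_meas rho_factor real (rho_solution.2 r real).
pose e n := \int[flow_marginal rho]_m max_gap Psi m0 rho1 f F m0N n m.
have e_cvg : e n @[n --> \oo] --> (0 : R).
  exact: (cvg_integral_max_gap Psi_meas f_meas F_meas f_le F_le m0N_cvg p_modulus
    A2_f A2_F cons).
(* The gap is paid for [id] and for the deviation, whence the factor [2]; there is
   no game with fewer than two players. *)
pose eps N : R := if N is n.+2 then 2 * e n else 0.
exists eps; split.
- case=> [|[|n]] //=; rewrite mulr_ge0// Rintegral_ge0// => m _.
  exact: max_gap_ge0.
- case=> [|[|n]] //= hN i u.
  have gap := game_cost_gap Psi_meas f_meas F_meas f_le F_le m0 m0N rho_factor
    (gam_def n.+2 hN) hN.
  have := gap id i; have := gap u i; have := rho_solution.1 u.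
  rewrite -/(e n) !ler_distl => opt /andP[u1 u2] /andP[id1 id2].
  move: opt u1 u2 id1 id2; lra.
- rewrite -(cvg_shiftn 2).
  rewrite (_ : [sequence eps (n + 2)%N]_n = fun n => 2 * e n).
    by have := cvgM (cvg_cst (2 : R)) e_cvg; rewrite mulr0; exact.
  by apply/funext => n /=; rewrite addn2.
Qed.
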